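(* Consider a synchronous restless bandit problem $(\mathbf P^0,\mathbf P^1,\mathbf R^0,\mathbf R^1;\alpha)$ such that: (i) the bandit is unichain and strictly indexable; (ii) the unique fixed point $\mathbf m^*$ of $\phi$ is a uniform global attractor of the iterates $\Phi_t$, i.e. for every $\epsilon>0$ there is $T(\epsilon)$ such that $\|\Phi_t(\mathbf m)-\mathbf m^*\|\le\epsilon$ for all $t\ge T(\epsilon)$ and all $\mathbf m\in\Delta^d$; (iii) $\mathbf m^*$ is not singular. Then there exist constants $b,c>0$ depending only on $\mathbf P^0,\mathbf P^1,\mathbf R^0,\mathbf R^1,\alpha$ such that for every $N$ with $\alpha N\in\mathbb N$, $$0\le V^{(N)}_{\mathrm{rel}}(\alpha)-V^{(N)}_{\mathrm{WIP}}(\alpha)\le b\,e^{-cN}.$$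
   Context: Synchronous restless bandit model: fix $d\ge2$, $d\times d$ stochastic matrices $\mathbf P^0=(P^0_{ij}),\mathbf P^1=(P^1_{ij})$, rewards $\mathbf R^0,\mathbf R^1\in\mathbb R^d$, $\alpha\in(0,1)$; $N$ bandits with states $S_n(t)\in\{1,\dots,d\}$; at each $t\in\mathbb N$ an action vector $\mathbf a(t)\in\{0,1\}^N$ is chosen; given states and actions bandits move independently with $\mathbb P(S_n(t+1)=j\mid S_n(t)=i,a_n(t)=a)=P^a_{ij}$; reward at time $t$ is $\sum_n R^{a_n(t)}_{S_n(t)}$. $V^{(N)}_{\mathrm{rel}}(\alpha)$ is the supremum over stationary Markov policies of the long-run average expected reward $\lim_T\frac1T\mathbb E[\sum_{t<T}\sum_nR^{a_n(t)}_{S_n(t)}]$ under the constraint $\lim_T\frac1T\sum_{t<T}\sum_na_n(t)=\alpha N$. Unichain: under every policy a single bandit's state space is one recurrent class. Indexability: the subsidy-$\nu$ problem is the single-bandit MDP where action $1$ in state $i$ earns $R^1_i$ and action $0$ earns $R^0_i+\nu$ (long-run average criterion); $\omega(\nu)$ is the set of states where some optimal policy is passive; indexable means $\omega(\nu)\subseteq\omega(\nu')$ for $\nu\le\nu'$; Whittle index $\nu_i=\inf\{\nu:i\in\omega(\nu)\}$; strictly indexable means all $\nu_i$ distinct, and states are labeled so that $\nu_1>\dots>\nu_d$. WIP: at each time activate the $\alpha N$ bandits with the highest Whittle indices of their current states; $V^{(N)}_{\mathrm{WIP}}(\alpha)$ is its long-run average expected reward. $\Delta^d=\{\mathbf m\in[0,1]^d:\sum_im_i=1\}$.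 For $\mathbf m\in\Delta^d$, $s(\mathbf m)$ is the unique $s$ with $\sum_{i<s}m_i\le\alpha<\sum_{i\le s}m_i$. The map $\phi:\Delta^d\to\Delta^d$ (the expected next configuration under WIP) is $\phi_j(\mathbf m)=\sum_{i=1}^{s(\mathbf m)-1} m_i P^1_{ij} + (\alpha-\sum_{i=1}^{s(\mathbf m)-1}m_i)P^1_{s(\mathbf m)j} + (\sum_{i=1}^{s(\mathbf m)}m_i - \alpha)P^0_{s(\mathbf m)j} + \sum_{i=s(\mathbf m)+1}^{d} m_i P^0_{ij}$; under the hypotheses it has a unique fixed point $\mathbf m^*$. $\Phi_0=\mathrm{id}$, $\Phi_{t+1}=\phi\circ\Phi_t$. A point $\mathbf m$ is singular if $\sum_{j=1}^i m_j=\alpha$ for some $i\in\{1,\dots,d\}$. $\|\cdot\|$ is the sup norm. *)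

(* Defs.v *)
From HB Require Import structures.
From mathcomp Require Import all_boot all_order all_algebra.
From mathcomp Require Import all_classical all_reals all_analysis.

Set Implicit Arguments.
Unset Strict Implicit.
Unset Printing Implicit Defensive.

Import Order.TTheory GRing.Theory Num.Theory.
Import numFieldNormedType.Exports.
Local Open Scope classical_set_scope.
Local Open Scope ring_scope.

Section RB.
Variable R : realType.
Variable d : nat.

Definition stochastic (P : 'M[R]_d) : Prop :=
  (forall i j, 0 <= P i j) /\ (forall i, \sum_j P i j = 1).

Definition Ppol (P0 P1 : 'M[R]_d) (sigma : 'I_d -> bool) : 'M[R]_d :=
  \matrix_(i, j) (if sigma i then P1 i j else P0 i j).

Definition mxpow (M : 'M[R]_d) (k : nat) : 'M[R]_d := iter k (mulmx M) 1%:M.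

(* unichain: under every (stationary) policy the whole state space of a
   single bandit is one recurrent class, i.e. the chain is irreducible *)
Definition unichain (P0 P1 : 'M[R]_d) : Prop :=
  forall sigma : 'I_d -> bool, forall i j : 'I_d,
    exists k : nat, 0 < mxpow (Ppol P0 P1 sigma) k i j.

Definition subsidy_reward (r0 r1 : 'I_d -> R) (nu : R) (sigma : 'I_d -> bool)
  (i : 'I_d) : R := if sigma i then r1 i else r0 i + nu.

Definition gain (P0 P1 : 'M[R]_d) (r0 r1 : 'I_d -> R) (nu : R)
  (sigma : 'I_d -> bool) (i0 : 'I_d) : R :=
  limn (fun T : nat => T%:R^-1 * \sum_(t < T) \sum_j
          mxpow (Ppol P0 P1 sigma) t i0 j * subsidy_reward r0 r1 nu sigma j).

Definition subsidy_optimal (P0 P1 : 'M[R]_d) (r0 r1 : 'I_d -> R) (nu : R)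
  (sigma : 'I_d -> bool) : Prop :=
  forall (sigma' : 'I_d -> bool) (i0 : 'I_d),
    gain P0 P1 r0 r1 nu sigma' i0 <= gain P0 P1 r0 r1 nu sigma i0.

Definition omega (P0 P1 : 'M[R]_d) (r0 r1 : 'I_d -> R) (nu : R) : set 'I_d :=
  [set i | exists sigma, subsidy_optimal P0 P1 r0 r1 nu sigma /\ sigma i = false].

Definition indexable (P0 P1 : 'M[R]_d) (r0 r1 : 'I_d -> R) : Prop :=
  forall nu nu' : R, nu <= nu' -> omega P0 P1 r0 r1 nu `<=` omega P0 P1 r0 r1 nu'.

Definition whittle (P0 P1 : 'M[R]_d) (r0 r1 : 'I_d -> R) (i : 'I_d) : R :=
  inf [set nu | omega P0 P1 r0 r1 nu i].

Definition strictly_indexable_labeled (P0 P1 : 'M[R]_d) (r0 r1 : 'I_d -> R)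
  : Prop :=
  indexable P0 P1 r0 r1 /\
  (forall i j : 'I_d, (i < j)%N -> whittle P0 P1 r0 r1 j < whittle P0 P1 r0 r1 i).

(** ** Mean-field map phi (states 1..d of the paper are 0..d-1 here) *)

Definition simplex (m : 'I_d -> R) : Prop :=
  (forall i, 0 <= m i <= 1) /\ \sum_i m i = 1.

Definition s_of (alpha : R) (m : 'I_d -> R) : nat :=
  odflt 0%N (omap (@nat_of_ord d)
    [pick s : 'I_d | (\sum_(i < d | (i < s)%N) m i <= alpha)
                     && (alpha < \sum_(i < d | (i <= s)%N) m i)]).

Definition phi (P0 P1 : 'M[R]_d) (alpha : R) (m : 'I_d -> R) : 'I_d -> R :=
  fun j =>
    let s := s_of alpha m in
    \sum_(i < d | (i < s)%N) m i * P1 i j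
    + \sum_(i < d | i == s :> nat)
        ((alpha - \sum_(k < d | (k < s)%N) m k) * P1 i j
         + (\sum_(k < d | (k <= s)%N) m k - alpha) * P0 i j)
    + \sum_(i < d | (s < i)%N) m i * P0 i j.

Definition Phi (P0 P1 : 'M[R]_d) (alpha : R) (t : nat) (m : 'I_d -> R)
  : 'I_d -> R := iter t (phi P0 P1 alpha) m.

Definition supnorm (m : 'I_d -> R) : R := \big[Num.max/0]_(i < d) `|m i|.

Definition uniform_global_attractor (P0 P1 : 'M[R]_d) (alpha : R)
  (mstar : 'I_d -> R) : Prop :=
  forall eps : R, 0 < eps -> exists T : nat, forall t : nat, (T <= t)%N ->
    forall m, simplex m ->
      supnorm (fun j => Phi P0 P1 alpha t m j - mstar j) <= eps.

Definition singular (alpha : R) (m : 'I_d -> R) : Prop :=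
  exists i : 'I_d, \sum_(j < d | (j <= i)%N) m j = alpha.

Variable N : nat.

Definition gstate := {ffun 'I_N -> 'I_d}.
Definition gaction := {ffun 'I_N -> bool}.

(* P(S(t+1) = y | S(t) = x, a(t) = a): bandits move independently *)
Definition Ktrans (P0 P1 : 'M[R]_d) (x : gstate) (a : gaction) (y : gstate) : R :=
  \prod_(n < N) (if a n then P1 (x n) (y n) else P0 (x n) (y n)).

Definition greward (r0 r1 : 'I_d -> R) (x : gstate) (a : gaction) : R :=
  \sum_(n < N) (if a n then r1 (x n) else r0 (x n)).

Definition nactive (a : gaction) : R := (\sum_(n < N) (a n : nat))%:R.

Definition is_policy (pi : gstate -> gaction -> R) : Prop :=
  (forall x a, 0 <= pi x a) /\ (forall x, \sum_a pi x a = 1).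

Fixpoint distr (P0 P1 : 'M[R]_d) (pi : gstate -> gaction -> R) (x0 : gstate)
  (t : nat) : gstate -> R :=
  match t with
  | 0%N => fun x => (x == x0)%:R
  | t'.+1 => fun y => \sum_x distr P0 P1 pi x0 t' x *
                       \sum_a pi x a * Ktrans P0 P1 x a y
  end.

Definition exp_reward (P0 P1 : 'M[R]_d) (r0 r1 : 'I_d -> R)
  (pi : gstate -> gaction -> R) (x0 : gstate) (t : nat) : R :=
  \sum_x distr P0 P1 pi x0 t x * \sum_a pi x a * greward r0 r1 x a.

Definition avg_reward (P0 P1 : 'M[R]_d) (r0 r1 : 'I_d -> R)
  (pi : gstate -> gaction -> R) (x0 : gstate) (T : nat) : R :=
  T%:R^-1 * \sum_(t < T) exp_reward P0 P1 r0 r1 pi x0 t.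

Definition path_at (x0 : gstate) (L : nat) (p : {ffun 'I_L -> gstate * gaction})
  (t : nat) : gstate * gaction :=
  oapp p (x0, [ffun=> false]) (insub t).

Definition path_prob (P0 P1 : 'M[R]_d) (pi : gstate -> gaction -> R)
  (x0 : gstate) (L : nat) (p : {ffun 'I_L -> gstate * gaction}) : R :=
  let q := path_at x0 p in
  (if L is 0%N then 1 else ((q 0%N).1 == x0)%:R) *
  \prod_(t < L) pi (q t).1 (q t).2 *
  \prod_(t < L | (t.+1 < L)%N) Ktrans P0 P1 (q t).1 (q t).2 (q t.+1).1.

Definition dev_event (x0 : gstate) (c eps : R) (T L : nat)
  (p : {ffun 'I_L -> gstate * gaction}) : bool :=
  [exists T' : 'I_L.+1, (T <= T')%N &&
     (eps < `| (T'%:R)^-1 * \sum_(t < T') nactive (path_at x0 p t).2 - c |)].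

(* almost surely, lim_T (1/T) sum_{t<T} sum_n a_n(t) = c; expressed through
   the finite-dimensional path distributions:
   forall eps, P( sup_{T' >= T} |avg_{T'} - c| > eps ) -> 0 as T -> oo *)
Definition as_activation_limit (P0 P1 : 'M[R]_d) (pi : gstate -> gaction -> R)
  (x0 : gstate) (c : R) : Prop :=
  forall eps delta : R, 0 < eps -> 0 < delta ->
    exists T : nat, (1 <= T)%N /\ forall L : nat, (T <= L)%N ->
      \sum_(p : {ffun 'I_L -> gstate * gaction} | dev_event x0 c eps T p)
         path_prob P0 P1 pi x0 p <= delta.

Definition V_rel (P0 P1 : 'M[R]_d) (r0 r1 : 'I_d -> R) (alpha : R)
  (x0 : gstate) : R :=
  sup [set v : R | exists pi : gstate -> gaction -> R,
         [/\ is_policy pi,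
             as_activation_limit P0 P1 pi x0 (alpha * N%:R) &
             avg_reward P0 P1 r0 r1 pi x0 n @[n --> \oo] --> v]].

(* Whittle index policy with budget k = alpha N: activate the k bandits
   with highest Whittle index of their current state (ties, which only
   occur between bandits in the same state, broken by bandit number) *)
Definition wip_action (nu : 'I_d -> R) (k : nat) (x : gstate) : gaction :=
  [ffun n => (#|[set m : 'I_N | (nu (x n) < nu (x m))%R
                  || ((nu (x m) == nu (x n)) && (m < n)%N)]| < k)%N].

Definition wip_policy (nu : 'I_d -> R) (k : nat) : gstate -> gaction -> R :=
  fun x a => (a == wip_action nu k x)%:R.

Definition V_WIP (P0 P1 : 'M[R]_d) (r0 r1 : 'I_d -> R) (k : nat)
  (x0 : gstate) : R :=
  limn (avg_reward P0 P1 r0 r1 (wip_policy (whittle P0 P1 r0 r1) k) x0).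

End RB.

(* Main.v *)
(* Fix the subsidy nu_s for the state s at which the budget runs out in m*.  The
   threshold policies just above and just below s are both optimal for this
   subsidy, so they share a Bellman solution (g, h), and both actions are free
   of loss in state s.  For any policy of the N-bandit system, the Bellman equation
   summed over the bandits and over time gives
     average reward = N (g - nu_s) + nu_s (average activation)
                      - (average total Bellman gap) + O(1/T).
   As gaps are nonnegative, V_rel <= U := N (g - nu_s) + nu_s alpha N.  Under WIP
   the total gap vanishes as soon as the configuration is so close to m* that
   the budget runs out in s, and it is O(N) otherwise.  By Chernoff bounds, the
   Lipschitz continuity of phi and the uniform attraction to m*, from any
   initial state the configuration is away from m* after a fixed number of steps
   with probability O(exp(-c N)); hence V_WIP >= U - O(N exp(-c N)). *)
Require Import Defs.
From HB Require Import structures.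
From mathcomp Require Import all_boot all_order all_algebra.
From mathcomp Require Import all_classical all_reals all_analysis.
From mathcomp Require Import ring lra zify.

Set Implicit Arguments.
Unset Strict Implicit.
Unset Printing Implicit Defensive.

Import Order.TTheory GRing.Theory Num.Theory.
Import numFieldNormedType.Exports.
Local Open Scope classical_set_scope.
Local Open Scope ring_scope.

(** * Finite Markov chains *)

Section FiniteMarkovChain.
Variables (R : realType) (T : finType).
Implicit Types (K : T -> T -> R) (f h r : T -> R).

Definition stochastic_kernel K : Prop :=
  (forall x y, 0 <= K x y) /\ (forall x, \sum_y K x y = 1).

Definition kapp K f : T -> R := fun x => \sum_y K x y * f y.

Lemma kappD K f h : kapp K (fun x => f x + h x) = (fun x => kapp K f x + kapp K h x).
Proof.
by apply/funext => x; rewrite /kapp -big_split; apply: eq_bigr => y _; rewrite mulrDr.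
Qed.

Lemma kappZ K a f : kapp K (fun x => a * f x) = (fun x => a * kapp K f x).
Proof.
by apply/funext => x; rewrite /kapp mulr_sumr; apply: eq_bigr => y _; rewrite mulrCA.
Qed.

Lemma kapp_cst K a : stochastic_kernel K -> kapp K (fun=> a) = (fun=> a).
Proof. by case=> _ K1; apply/funext => x; rewrite /kapp -mulr_suml K1 mul1r. Qed.

Lemma ler_kapp K f h x : stochastic_kernel K -> (forall y, f y <= h y) -> kapp K f x <= kapp K h x.
Proof. by case=> K0 _ fh; apply: ler_sum => y _; apply: ler_wpM2l. Qed.

Lemma iter_kappD K t f h :
  iter t (kapp K) (fun x => f x + h x) =
  (fun x => iter t (kapp K) f x + iter t (kapp K) h x).
Proof. by elim: t => //= t ->; rewrite kappD. Qed.

Lemma iter_kappZ K t a f :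
  iter t (kapp K) (fun x => a * f x) = (fun x => a * iter t (kapp K) f x).
Proof. by elim: t => //= t ->; rewrite kappZ. Qed.

Lemma iter_kapp_cst K t a : stochastic_kernel K -> iter t (kapp K) (fun=> a) = (fun=> a).
Proof. by move=> Kk; elim: t => //= t ->; rewrite kapp_cst. Qed.

Lemma ler_iter_kapp K t f h x : stochastic_kernel K -> (forall y, f y <= h y) ->
  iter t (kapp K) f x <= iter t (kapp K) h x.
Proof. by move=> Kk fh; elim: t x => //= t IH x; apply: ler_kapp. Qed.

Lemma fin_bounded f : exists2 b, 0 <= b & forall x, `|f x| <= b.
Proof.
exists (\sum_x `|f x|) => [|x]; first exact: sumr_ge0.
by rewrite (bigD1 x) //= lerDl sumr_ge0.
Qed.

Lemma iter_kapp_bounded K f b t x : stochastic_kernel K -> (forall y, `|f y| <= b) ->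
  `|iter t (kapp K) f x| <= b.
Proof.
move=> Kk fb; rewrite ler_norml; apply/andP; split.
  rewrite -[X in X <= _](congr1 (fun g => g x) (iter_kapp_cst t (- b) Kk)).
  by apply: ler_iter_kapp => // y; have := fb y; rewrite ler_norml => /andP[].
rewrite -[X in _ <= X](congr1 (fun g => g x) (iter_kapp_cst t b Kk)).
by apply: ler_iter_kapp => // y; have := fb y; rewrite ler_norml => /andP[].
Qed.

(** Iterates of [h - K h] telescope, and [c] is invariant. *)
Lemma sum_iter_kapp K c h r n x : (forall x, kapp K c x = c x) ->
  (forall x, r x = c x + h x - kapp K h x) ->
  \sum_(t < n) iter t (kapp K) r x = n%:R * c x + h x - iter n (kapp K) h x.
Proof.
move=> Kc rE.
have cE t : iter t (kapp K) c = c by elim: t => //= t ->; apply/funext.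
have -> : r = fun x => (c x + h x) + (-1) * kapp K h x.
  by apply/funext => y; rewrite rE mulN1r.
elim: n => [|n IH]; first by rewrite big_ord0 mul0r add0r subrr.
rewrite big_ord_recr /= IH.
have -> : iter n (kapp K) (fun y => c y + h y + -1 * kapp K h y) x =
    c x + iter n (kapp K) h x - iter n.+1 (kapp K) h x.
  rewrite (iter_kappD K n (fun y => c y + h y)) iter_kappD iter_kappZ cE.
  by rewrite -iterSr mulN1r.
by rewrite /= -natr1; ring.
Qed.

Lemma linear_bounded_eq0 (v b : R) : (forall n : nat, `|n%:R * v| <= b) -> v = 0.
Proof.
move=> H; apply/eqP/negPn/negP => v0.
have nv : 0 < `|v| by rewrite normr_gt0.
have := H (Num.truncn (b / `|v|)).+1; rewrite normrM normr_nat leNgt => /negP; apply.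
by rewrite -ltr_pdivrMr // truncnS_gt.
Qed.

(* A stochastic kernel is power bounded, so ker (1 - K) and im (1 - K) meet
   trivially; by rank-nullity they span the whole space. *)
Lemma mean_ergodic K r : stochastic_kernel K ->
  exists c h, (forall x, kapp K c x = c x) /\
              (forall x, r x = c x + h x - kapp K h x).
Proof.
move=> Kk.
pose n := #|T|.
(* Functions become row vectors, so [A] is the transpose of [1 - K] and [u *m A] encodes
   [f - K f]. *)
pose A : 'M[R]_n := \matrix_(i, j) ((i == j)%:R - K (enum_val j) (enum_val i)).
pose fn (u : 'rV[R]_n) : T -> R := fun x => u 0 (enum_rank x).
pose vc (f : T -> R) : 'rV[R]_n := \row_i f (enum_val i).
have fnA u x : fn (u *m A) x = fn u x - kapp K (fn u) x.
  rewrite /fn mxE.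
  under eq_bigr do rewrite mxE mulrBr.
  rewrite sumrB; congr (_ - _).
    rewrite (bigD1 (enum_rank x)) //= eqxx mulr1 big1 ?addr0 // => i /negbTE->.
    by rewrite mulr0.
  rewrite /kapp (reindex (@enum_rank T)) /=; last first.
    by exists (@enum_val T T) => y _; rewrite ?enum_rankK ?enum_valK.
  by apply: eq_bigr => y _; rewrite !enum_rankK mulrC.
(* Here [v = u - K u] is invariant, so its first m iterates sum to [m * v]; they also telescope to
   [u - K^m u], which is bounded in m. Hence [v = 0]. *)
have AA0 (u : 'rV[R]_n) : u *m A *m A = 0 -> u *m A = 0.
  move=> u0.
  pose v := fn (u *m A).
  have Kv x : kapp K v x = v x.
    have := fnA (u *m A) x; rewrite u0 /fn mxE -/(fn _) => /esym/eqP.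
    by rewrite subr_eq0 => /eqP <-.
  have [b b0 ub] := fin_bounded (fn u).
  suff v0 x : v x = 0.
    apply/rowP => i; have := v0 (enum_val i).
    by rewrite /v /fn enum_valK => ->; rewrite mxE.
  apply: (@linear_bounded_eq0 _ (b + b)) => m.
  have zE y : v y = v y + (fun y => 0 * fn u y) y - kapp K (fun y => 0 * fn u y) y.
    by rewrite kappZ !mul0r subr0 addr0.
  have := sum_iter_kapp m x Kv zE.
  have rE y : v y = (fun=> 0) y + fn u y - kapp K (fn u) y by rewrite /v fnA add0r.
  have K0 y : kapp K (fun=> 0) y = 0 by rewrite kapp_cst.
  rewrite (sum_iter_kapp m x K0 rE) iter_kappZ !mul0r mulr0 add0r subr0 addr0 => <-.
  by rewrite (le_trans (ler_normB _ _)) // lerD // iter_kapp_bounded.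
have cap0 : (A :&: kermx A)%MS = 0.
  apply/eqP; rewrite -submx0; apply/rV_subP => w.
  rewrite sub_capmx => /andP[/submxP[u ->] /sub_kermxP uAA].
  by rewrite AA0 // submx0.
have rk : \rank (A + kermx A)%MS = n.
  rewrite mxrank_disjoint_sum // mxrank_ker subnKC //; exact: rank_leq_row.
have /sub_addsmxP[[u w] /= rE] : (vc r <= A + kermx A)%MS.
  by apply: submx_full; rewrite /row_full rk.
exists (fn (w *m kermx A)), (fn u); split => x.
  have := fnA (w *m kermx A) x; rewrite -mulmxA mulmx_ker mulmx0 {1}/fn mxE => /eqP.
  by rewrite eq_sym subr_eq0 => /eqP <-.
have -> : r x = fn (vc r) x by rewrite /fn mxE enum_rankK.
by rewrite rE -addrA -fnA /fn mxE addrC.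
Qed.

Lemma bounded_div_cvg0 (u : nat -> R) b : (forall n, `|u n| <= b) ->
  (fun n : nat => n%:R^-1 * u n) @ \oo --> (0 : R).
Proof.
move=> ub.
have c0 : (fun n : nat => b * (n%:R^-1 : R)) @ \oo --> (0 : R).
  rewrite -(mulr0 b); apply: cvgM; first exact: cvg_cst.
  apply/cvgrPdist_lt => e e0; near=> n.
  rewrite sub0r normrN ger0_norm ?invr_ge0 ?ler0n //.
  have n0 : (0 < n)%N by near: n; exists 1%N.
  rewrite invf_plt ?posrE ?ltr0n //.
  near: n; exists (Num.truncn (e^-1)).+1 => // m /= hm.
  by rewrite (lt_le_trans (truncnS_gt _)) // ler_nat.
apply: (@squeeze_cvgr _ _ _ _ (fun n : nat => - (b * n%:R^-1)) (fun n : nat => b * n%:R^-1)).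
- apply: nearW => n; rewrite -ler_norml normrM ger0_norm ?invr_ge0 ?ler0n // mulrC.
  by apply: ler_wpM2r; rewrite ?invr_ge0 ?ler0n.
- by rewrite -oppr0; apply: cvgN.
- exact: c0.
Unshelve. all: by end_near. Qed.

Lemma cesaro_cvg K c h r x : stochastic_kernel K -> (forall x, kapp K c x = c x) ->
  (forall x, r x = c x + h x - kapp K h x) ->
  (fun n : nat => n%:R^-1 * \sum_(t < n) iter t (kapp K) r x) @ \oo --> c x.
Proof.
move=> Kk Kc rE.
have [b b0 hb] := fin_bounded h.
pose u n := h x - iter n (kapp K) h x.
have : (fun n : nat => c x + n%:R^-1 * u n) @ \oo --> c x + 0.
  apply: cvgD; first exact: cvg_cst.
  apply: (@bounded_div_cvg0 _ (b + b)) => n.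
  by rewrite (le_trans (ler_normB _ _)) // lerD // iter_kapp_bounded.
rewrite addr0; apply: cvg_trans; apply: near_eq_cvg.
exists 1%N => // n /= n1.
have n0 : (n%:R : R) != 0 by rewrite pnatr_eq0 -lt0n.
by rewrite (sum_iter_kapp n x Kc rE) /u; field.
Qed.

Definition irreducible K : Prop :=
  forall x y, exists t, 0 < iter t (kapp K) (fun z => (z == y)%:R) x.

(* Minimum principle: at a minimiser x0, K f <= f forces f to be minimal at
   every point that the chain reaches from x0. *)
Lemma superharmonic_cst K f : stochastic_kernel K -> irreducible K ->
  (forall x, kapp K f x <= f x) -> forall x y, f x = f y.
Proof.
move=> Kk Ki Kf.
suff min x y : f x <= f y by move=> x y; apply/eqP; rewrite eq_le !min.
case: (arg_minP (P := xpredT) f (i0 := x) isT) => z _ zmin.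
suff fz w : f w <= f z by apply: le_trans (fz x) (zmin y isT).
have itf t v : iter t (kapp K) f v <= f v.
  elim: t v => //= t IH v; apply: (le_trans _ (Kf v)); exact: ler_kapp.
have [t ht] := Ki z w.
(* This minorant of [f] sees only the point [w]. Its t-step mean from [z] is [f z] plus [f w - f z]
   times a positive probability, and it must not exceed [f z]. *)
have lb v : f z + (f w - f z) * (v == w)%:R <= f v.
  have [->|vw] := eqVneq v w; first by rewrite mulr1 addrC subrK.
  by rewrite mulr0 addr0 zmin.
have := le_trans (ler_iter_kapp t z Kk lb) (itf t z).
rewrite (iter_kappD K t (fun=> f z)) iter_kapp_cst // iter_kappZ gerDl.
by rewrite pmulr_lle0 // subr_le0.
Qed.

End FiniteMarkovChain.

(** * The single-bandit subsidy problem *)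

Section PoissonEquation.
Variables (R : realType) (T : finType).
Implicit Types (K : T -> T -> R) (f h r : T -> R).

(** The average-reward evaluation equation: [g] is the gain and [h] the bias. *)
Definition poisson K r (g : R) h : Prop := forall x, g + h x = r x + kapp K h x.

Lemma poissonD K r r' g g' h h' a : poisson K r g h -> poisson K r' g' h' ->
  poisson K (fun x => r x + a * r' x) (g + a * g') (fun x => h x + a * h' x).
Proof.
move=> H H' x; rewrite kappD kappZ.
have -> : g + a * g' + (h x + a * h' x) = (g + h x) + a * (g' + h' x) by ring.
by rewrite H H'; ring.
Qed.

Lemma poisson_cst K a : stochastic_kernel K -> poisson K (fun=> a) a (fun=> 0).
Proof. by move=> Kk x; rewrite kapp_cst. Qed.

Lemma eq_poisson K r r' g h : r =1 r' -> poisson K r g h -> poisson K r' g h.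
Proof. by move=> rr' H x; rewrite -rr'. Qed.

Lemma irreducible_poisson K r : stochastic_kernel K -> irreducible K -> exists g h, poisson K r g h.
Proof.
move=> Kk Ki; have [c [h [Kc rE]]] := mean_ergodic r Kk.
have Kc_le x : kapp K c x <= c x by rewrite Kc.
have cc := superharmonic_cst Kk Ki Kc_le.
have [x0 _|T0] := pickP (fun _ : T => true).
  by exists (c x0), h => x; rewrite rE (cc x x0); ring.
by exists 0, h => x; have := T0 x.
Qed.

(** If [g <= 0], then [K h = g + h - r <= h], so [h] is superharmonic, hence constant, and [r]
    equals [g] everywhere; nonnegativity of [r] leaves only zero. Applied to Bellman differences,
    this decides both the sign of a gain difference and when it vanishes. *)
Lemma poisson_ge0 K r g h : stochastic_kernel K -> irreducible K -> poisson K r g h ->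
  (forall x, 0 <= r x) -> forall x, 0 <= g /\ (g <= 0 -> r x = 0).
Proof.
move=> Kk Ki H r0 x.
have key : g <= 0 -> r x = g.
  move=> g0.
  have hh : forall x y, h x = h y.
    apply: (superharmonic_cst Kk Ki) => y.
    by have := H y; have := r0 y; lra.
  have := H x; have -> : h = fun=> h x by apply/funext => y; apply: hh.
  by rewrite kapp_cst //; lra.
have g0 : 0 <= g.
  by rewrite leNgt; apply/negP => gn; have := r0 x; rewrite (key (ltW gn)) leNgt gn.
by split=> // gn; rewrite key //; apply: le_anti; rewrite gn g0.
Qed.

End PoissonEquation.

Lemma affine_le0_at0 (R : realType) (a b t0 : R) : 0 < t0 ->
  (forall t, 0 < t <= t0 -> a + t * b <= 0) -> a <= 0.
Proof.
move=> t00 H; rewrite leNgt; apply/negP => a0.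
have b0 : 0 <= `|b| by [].
have den : 0 < a + t0 * `|b| by nra.
(* Chosen so that [t <= t0] and [t * |b| < a], which would make [a + t * b] positive. *)
pose t := t0 * a / (a + t0 * `|b|).
have tE : t * (a + t0 * `|b|) = t0 * a by rewrite /t divfK // gt_eqF.
have tpos : 0 < t by rewrite divr_gt0 // mulr_gt0.
have tle : t <= t0 by rewrite /t ler_pdivrMr //; nra.
have := H t; rewrite tpos tle => /(_ isT).
have bb : - `|b| <= b by rewrite lerNl -normrN ler_norm.
move=> le0; have tb := ler_wpM2l (ltW tpos) bb.
have al : a <= t * `|b| by lra.
have := ler_wpM2l (ltW t00) al; have := mulr_gt0 tpos a0.
lra.
Qed.

(** * Optimality equations, Whittle indices and threshold policies *)

Section SubsidyProblem.
Variables (R : realType) (d : nat) (P0 P1 : 'M[R]_d) (r0 r1 : 'I_d -> R).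
Hypothesis SP0 : stochastic P0.
Hypothesis SP1 : stochastic P1.
Hypothesis Huni : unichain P0 P1.

Let polK (sigma : 'I_d -> bool) : 'I_d -> 'I_d -> R := fun i j => Ppol P0 P1 sigma i j.

Lemma mxpow_iter (M : 'M[R]_d) t i (f : 'I_d -> R) :
  \sum_j mxpow M t i j * f j = iter t (kapp (fun i j => M i j)) f i.
Proof.
elim: t i => [|t IH] i.
  rewrite /= (bigD1 i) //= big1 => [|j /negbTE ji]; rewrite mxE ?eqxx ?mul1r ?addr0 //.
  by rewrite eq_sym ji mul0r.
rewrite /= /kapp.
under eq_bigr do rewrite mxE mulr_suml.
rewrite exchange_big /=; apply: eq_bigr => k _.
by rewrite -IH mulr_sumr; apply: eq_bigr => j _; rewrite mulrA.
Qed.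

Let kpol sigma : stochastic_kernel (polK sigma).
Proof.
case: SP0 => a0 b0; case: SP1 => a1 b1; split=> [x y|x].
  by rewrite /polK mxE; case: ifP.
case sx: (sigma x); [rewrite -(b1 x)|rewrite -(b0 x)].
  by apply: eq_bigr => j _; rewrite /polK mxE sx.
by apply: eq_bigr => j _; rewrite /polK mxE sx.
Qed.

Let ipol sigma : irreducible (polK sigma).
Proof.
move=> i j; have [k hk] := Huni sigma i j; exists k.
rewrite -mxpow_iter (bigD1 j) //= eqxx mulr1 big1 ?addr0 // => z /negbTE ->.
by rewrite mulr0.
Qed.

Lemma poisson_gain nu sigma g h i :
  poisson (polK sigma) (subsidy_reward r0 r1 nu sigma) g h ->
  gain P0 P1 r0 r1 nu sigma i = g.
Proof.
move=> H; rewrite /gain.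
have rE x : subsidy_reward r0 r1 nu sigma x = (fun=> g) x + h x - kapp (polK sigma) h x.
  by rewrite H addrK.
have gE x : kapp (polK sigma) (fun=> g) x = g by rewrite kapp_cst.
have := cesaro_cvg (x := i) (kpol sigma) gE rE.
under [X in X @ _ --> _]eq_fun do under eq_bigr do rewrite -mxpow_iter.
by move/cvg_lim => -> //.
Qed.

Let passive (sigma : 'I_d -> bool) (i : 'I_d) : R := (~~ sigma i)%:R.

(** The subsidy enters the reward as [nu] times the indicator of passivity, and evaluation equations
    are linear in the reward. The slope [B] is the long-run fraction of passive time; the strict
    bounds come from irreducibility, since every state is visited with positive frequency. *)
Lemma gain_affine : exists A B : ('I_d -> bool) -> R,
  [/\ forall nu sigma i, gain P0 P1 r0 r1 nu sigma i = A sigma + nu * B sigma,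
      forall (sigma : 'I_d -> bool) i, ~~ sigma i -> 0 < B sigma,
      forall (sigma : 'I_d -> bool) i, sigma i -> B sigma < 1 &
      forall sigma (i : 'I_d), 0 <= B sigma <= 1].
Proof.
have /choice[A /choice[hA HA]] : forall sigma, exists g h,
    poisson (polK sigma) (subsidy_reward r0 r1 0 sigma) g h.
  by move=> sigma; apply: irreducible_poisson.
have /choice[B /choice[hB HB]] : forall sigma, exists g h,
    poisson (polK sigma) (passive sigma) g h.
  by move=> sigma; apply: irreducible_poisson.
exists A, B.
have HB' sigma := poissonD (-1) (poisson_cst 1 (kpol sigma)) (HB sigma).
have p1 sigma i : 0 <= 1 + -1 * passive sigma i.
  by rewrite /passive; case: (sigma i) => /=; lra.
have b1 sigma i := poisson_ge0 (kpol sigma) (ipol sigma) (HB' sigma) (p1 sigma) i.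
have p0 sigma i : 0 <= passive sigma i by rewrite /passive ler0n.
have b0 sigma i := poisson_ge0 (kpol sigma) (ipol sigma) (HB sigma) (p0 sigma) i.
split.
- move=> nu sigma i; apply: (@poisson_gain _ _ _ (fun x => hA sigma x + nu * hB sigma x)).
  apply: eq_poisson (poissonD nu (HA sigma) (HB sigma)) => x.
  by rewrite /subsidy_reward /passive; case: (sigma x) => /=; lra.
- move=> sigma i si; rewrite ltNge; apply/negP => /(b0 sigma i).2.
  by rewrite /passive si => /eqP; rewrite oner_eq0.
- move=> sigma i si; rewrite ltNge; apply/negP => B1.
  have /(b1 sigma i).2 : 1 + -1 * B sigma <= 0 by lra.
  by rewrite /passive si mulr0 addr0 => /eqP; rewrite oner_eq0.
- move=> sigma i; rewrite (b0 sigma i).1 /=.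
  by have := (b1 sigma i).1; lra.
Qed.

Definition bellmanQ (nu : R) (h : 'I_d -> R) (i : 'I_d) (a : bool) : R :=
  if a then r1 i + \sum_j P1 i j * h j else r0 i + nu + \sum_j P0 i j * h j.

Lemma bellmanQE nu h sigma i :
  bellmanQ nu h i (sigma i) =
  subsidy_reward r0 r1 nu sigma i + kapp (polK sigma) h i.
Proof.
rewrite /bellmanQ /subsidy_reward /kapp; case si: (sigma i); congr (_ + _).
  by apply: eq_bigr => j _; rewrite /polK mxE si.
by apply: eq_bigr => j _; rewrite /polK mxE si.
Qed.

(** Performance difference formula: the advantages of [sigma'] relative to [(g, h)] form a reward
    whose gain is [g' - g]. *)
Let poisson_diff nu g h sigma' g' h' :
  poisson (polK sigma') (subsidy_reward r0 r1 nu sigma') g' h' ->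
  poisson (polK sigma') (fun i => bellmanQ nu h i (sigma' i) - (g + h i))
    (g' - g) (fun i => h' i + (-1) * h i).
Proof.
move=> H' i; rewrite kappD kappZ bellmanQE.
by have := H' i; lra.
Qed.

(** Policy improvement: if action [a] violated the inequality in state [i], switching to it there
    alone would give nonnegative advantages, positive at [i], hence a strictly larger gain. *)
Lemma optimal_bellman nu sigma g h :
  poisson (polK sigma) (subsidy_reward r0 r1 nu sigma) g h ->
  subsidy_optimal P0 P1 r0 r1 nu sigma ->
  forall i a, bellmanQ nu h i a <= g + h i.
Proof.
move=> H Hopt i a; rewrite leNgt; apply/negP => Qlt.
pose sigma' j := if j == i then a else sigma j.
have [g' [h' H']] := irreducible_poisson (subsidy_reward r0 r1 nu sigma')
  (kpol sigma') (@ipol sigma').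
have D0 j : 0 <= bellmanQ nu h j (sigma' j) - (g + h j).
  rewrite /sigma'; case: eqP => [->|_]; first by rewrite subr_ge0 ltW.
  by rewrite bellmanQE H subrr.
have [_] := poisson_ge0 (kpol sigma') (@ipol sigma') (poisson_diff g h H') D0 i.
have := Hopt sigma' i; rewrite (poisson_gain _ H') (poisson_gain _ H) => gg.
rewrite subr_le0 => /(_ gg); rewrite /sigma' eqxx => /eqP.
by rewrite subr_eq0 gt_eqF.
Qed.

(** All advantages are nonpositive, so no policy has gain above [g], and by irreducibility gain [g]
    forces every advantage to vanish. Conversely, a policy attaining the maxima has [(g, h)] as its
    own evaluation. *)
Lemma bellman_optimal nu sigma g h :
  poisson (polK sigma) (subsidy_reward r0 r1 nu sigma) g h ->
  (forall i a, bellmanQ nu h i a <= g + h i) ->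
  forall sigma', subsidy_optimal P0 P1 r0 r1 nu sigma' <->
    (forall i, bellmanQ nu h i (sigma' i) = g + h i).
Proof.
move=> H Hb sigma'; split => [Hopt i|E tau i].
  have [g' [h' H']] := irreducible_poisson (subsidy_reward r0 r1 nu sigma')
    (kpol sigma') (@ipol sigma').
  have HN := poissonD (-1) (poisson_cst 0 (kpol sigma')) (poisson_diff g h H').
  have D0 j : 0 <= 0 + -1 * (bellmanQ nu h j (sigma' j) - (g + h j)).
    by have := Hb j (sigma' j); lra.
  have [_] := poisson_ge0 (kpol sigma') (@ipol sigma') HN D0 i.
  have := Hopt sigma i; rewrite (poisson_gain _ H') (poisson_gain _ H) => gg.
  have le0 : 0 + -1 * (g' - g) <= 0 by lra.
  by move=> /(_ le0); lra.
have [g' [h' H']] := irreducible_poisson (subsidy_reward r0 r1 nu tau)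
    (kpol tau) (@ipol tau).
have HN := poissonD (-1) (poisson_cst 0 (kpol tau)) (poisson_diff g h H').
have D0 j : 0 <= 0 + -1 * (bellmanQ nu h j (tau j) - (g + h j)).
  by have := Hb j (tau j); lra.
have [gg _] := poisson_ge0 (kpol tau) (@ipol tau) HN D0 i.
have Hs : poisson (polK sigma') (subsidy_reward r0 r1 nu sigma') g h.
  by move=> x; rewrite -E bellmanQE.
by rewrite (poisson_gain _ H') (poisson_gain _ Hs); lra.
Qed.

Lemma subsidy_optimal_exists nu : exists sigma, subsidy_optimal P0 P1 r0 r1 nu sigma.
Proof.
have [A [B [gE _ _ _]]] := gain_affine.
pose F (s : {ffun 'I_d -> bool}) : R := A s + nu * B s.
case: (arg_maxP (P := xpredT) F (i0 := [ffun=> true]) isT) => s _ smax.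
exists s => tau i; rewrite !gE.
have -> : tau = [ffun x => tau x] :> ('I_d -> bool).
  by apply/funext => x; rewrite ffunE.
exact: smax.
Qed.

Hypothesis Hidx : indexable P0 P1 r0 r1.

(** For a large subsidy, permanent passivity is optimal, as its gain has slope 1 and every other
    policy has a smaller slope. With the lower bound that follows, the infimum defining the Whittle
    index is a genuine one. *)
Lemma omega_nonempty i : exists nu, omega P0 P1 r0 r1 nu i.
Proof.
have [A [B [gE B0 B1 B01]]] := gain_affine.
pose s0 : 'I_d -> bool := fun=> false.
have Bs0 : B s0 = 1.
  have [g1 H1] : exists h, poisson (polK s0) (passive s0) 1 h.
    by exists (fun=> 0) => x; rewrite kapp_cst // /passive.
  have e1 := gE 1 s0 i; have e0 := gE 0 s0 i.
  have [h0 [g0 H0]] := irreducible_poisson (subsidy_reward r0 r1 0 s0)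
    (kpol s0) (@ipol s0).
  have H2 := poissonD 1 H0 H1.
  have /(poisson_gain i) : poisson (polK s0) (subsidy_reward r0 r1 1 s0) (h0 + 1 * 1)
      (fun x => g0 x + 1 * g1 x).
    by apply: eq_poisson H2 => x; rewrite /subsidy_reward /passive /=; lra.
  by rewrite (poisson_gain i H0) in e0; rewrite e1; lra.
(* The subsidy at which the gain lines of [s] and of permanent passivity cross; finitely many
   policies give a common bound. *)
pose F (s : {ffun 'I_d -> bool}) : R := (A s - A s0) / (1 - B s).
have [b b0 bF] := fin_bounded F.
exists b; exists s0; split => // tau j; rewrite !gE Bs0 mulr1.
have -> : tau = [ffun x => tau x] :> ('I_d -> bool).
  by apply/funext => x; rewrite ffunE.
set s := [ffun x => tau x].
have [/existsP[z sz]|/existsPn sn] := boolP [exists z, s z]; last first.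
  have -> : (s : 'I_d -> bool) = s0 by apply/funext => z; apply/negbTE/sn.
  by rewrite Bs0 mulr1.
have lt1 := B1 s z sz.
have := le_trans (ler_norm _) (bF s); rewrite /F ler_pdivrMr ?subr_gt0 //.
by lra.
Qed.

Lemma omega_bounded_below i : exists b, forall nu, omega P0 P1 r0 r1 nu i -> b <= nu.
Proof.
have [A [B [gE B0 B1 B01]]] := gain_affine.
pose s1 : 'I_d -> bool := fun=> true.
have Bs1 : B s1 = 0.
  have H1 : poisson (polK s1) (passive s1) 0 (fun=> 0).
    by move=> x; rewrite kapp_cst // /passive.
  have e1 := gE 1 s1 i; have e0 := gE 0 s1 i.
  have [h0 [g0 H0]] := irreducible_poisson (subsidy_reward r0 r1 0 s1)
    (kpol s1) (@ipol s1).
  have /(poisson_gain i) H2 : poisson (polK s1) (subsidy_reward r0 r1 1 s1) h0 g0.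
    by apply: eq_poisson H0.
  by rewrite (poisson_gain i H0) in e0; move: e1; rewrite H2; lra.
(* The crossing point with permanent activity, whose line is flat; a policy passive somewhere beats
   it only to the right of this point. *)
pose F (s : {ffun 'I_d -> bool}) : R := (A s1 - A s) / B s.
have [b b0 bF] := fin_bounded F.
exists (- b) => nu [tau [topt ti]].
have := topt s1 i; rewrite !gE Bs1 mulr0 addr0.
have E : tau = [ffun x => tau x] :> ('I_d -> bool).
  by apply/funext => x; rewrite ffunE.
have := B0 tau i; rewrite ti => /(_ isT).
move: E; set s := [ffun x => tau x] => -> Bp Ale.
have bFs : - b <= F s by have := bF s; rewrite ler_norml => /andP[].
by apply: (le_trans bFs); rewrite /F ler_pdivrMr //; lra.
Qed.

Lemma omega_gt_whittle i nu : whittle P0 P1 r0 r1 i < nu -> omega P0 P1 r0 r1 nu i.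
Proof.
move=> lt; have [b bl] := omega_bounded_below i.
have hi : has_inf [set nu | omega P0 P1 r0 r1 nu i].
  split; first exact: omega_nonempty.
  by exists b => x; apply: bl.
have e0 : 0 < nu - whittle P0 P1 r0 r1 i by rewrite subr_gt0.
have [x /= ox xlt] := inf_adherent e0 hi.
apply: Hidx ox; rewrite ltW //; move: xlt; rewrite -/(whittle _ _ _ _ i); lra.
Qed.

Lemma not_omega_lt_whittle i nu : nu < whittle P0 P1 r0 r1 i -> ~ omega P0 P1 r0 r1 nu i.
Proof.
move=> lt o; have [b bl] := omega_bounded_below i.
move: lt; rewrite ltNge => /negP; apply; apply: inf_lbound => //.
by exists b => x; apply: bl.
Qed.

(* In an irreducible MDP a policy is optimal iff each of its actions attains the
   Bellman maximum, so optimal actions can be chosen state by state. *)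
Lemma threshold_optimal (c : nat) nu :
  (forall i : 'I_d, (i < c)%N -> nu < whittle P0 P1 r0 r1 i) ->
  (forall i : 'I_d, (c <= i)%N -> whittle P0 P1 r0 r1 i < nu) ->
  subsidy_optimal P0 P1 r0 r1 nu (fun i => (i < c)%N).
Proof.
move=> Hlt Hge; have [sigma so] := subsidy_optimal_exists nu.
have [g [h H]] := irreducible_poisson (subsidy_reward r0 r1 nu sigma)
    (kpol sigma) (@ipol sigma).
have Hb := bellman_optimal H (optimal_bellman H so).
apply/Hb => i; case: ltnP => ic.
  have <- : sigma i = true; last exact: (Hb sigma).1.
  by apply/negPn/negP => /negbTE si; apply: (not_omega_lt_whittle (Hlt i ic)); exists sigma.
have [tau [topt <-]] := omega_gt_whittle (Hge i ic).
exact: (Hb tau).1.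
Qed.

Hypothesis Hstrict : forall i j : 'I_d, (i < j)%N ->
  whittle P0 P1 r0 r1 j < whittle P0 P1 r0 r1 i.

Let whittle_le (i j : 'I_d) : (i <= j)%N ->
  whittle P0 P1 r0 r1 j <= whittle P0 P1 r0 r1 i.
Proof.
by rewrite leq_eqVlt => /orP[/eqP/val_inj->//|/Hstrict/ltW].
Qed.

(* The threshold policies just above and just below [s] are optimal on an
   interval of subsidies adjacent to [nu_s]; gains are affine in the subsidy, so
   both are still optimal at [nu_s] itself. *)
Lemma whittle_bellman (s : 'I_d) : exists g h,
  let nu := whittle P0 P1 r0 r1 s in
  [/\ forall i a, bellmanQ nu h i a <= g + h i,
      forall i : 'I_d, (i <= s)%N -> bellmanQ nu h i true = g + h i &
      forall i : 'I_d, (s <= i)%N -> bellmanQ nu h i false = g + h i].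
Proof.
set w := whittle P0 P1 r0 r1.
have [A [B [gE _ _ _]]] := gain_affine.
have opt1 : subsidy_optimal P0 P1 r0 r1 (w s) (fun i => (i < s.+1)%N).
  (* [lo] is the next lower index, or an arbitrary smaller number when [s] is the last state.
     Staying within half the distance to it keeps the subsidy strictly between the two indices. *)
  have [lo lows Hlo] : exists2 lo, lo < w s & forall i : 'I_d, (s < i)%N -> w i <= lo.
    have [sd|sd] := ltnP s.+1 d.
      exists (w (Ordinal sd)); first exact: Hstrict.
      by move=> i si; apply: whittle_le.
    exists (w s - 1) => [|i si]; first lra.
    by have := leq_trans (ltn_ord i) sd; rewrite ltnS leqNgt si.
  move=> tau i; rewrite !gE -subr_le0.
  apply: (@affine_le0_at0 _ _ (- (B tau - B (fun i => (i < s.+1)%N))) ((w s - lo) / 2)).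
    by lra.
  move=> t /andP[t0 tle].
  have /(_ tau i) : subsidy_optimal P0 P1 r0 r1 (w s - t) (fun i => (i < s.+1)%N).
    apply: threshold_optimal => j js.
      by have := whittle_le js; rewrite -/w; lra.
    by have := Hlo j js; rewrite -/w; lra.
  by rewrite !gE; lra.
have opt2 : subsidy_optimal P0 P1 r0 r1 (w s) (fun i => (i < s)%N).
  have [hi hiws Hhi] : exists2 hi, w s < hi & forall i : 'I_d, (i < s)%N -> hi <= w i.
    have [s0|s0] := posnP s.
      by exists (w s + 1) => [|i]; [lra|rewrite s0].
    have sd : (s.-1 < d)%N by rewrite (leq_ltn_trans (leq_pred _)).
    exists (w (Ordinal sd)); first by apply: Hstrict; rewrite /= prednK.
    by move=> i si; apply: whittle_le; rewrite /= -ltnS prednK.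
  move=> tau i; rewrite !gE -subr_le0.
  apply: (@affine_le0_at0 _ _ (B tau - B (fun i => (i < s)%N)) ((hi - w s) / 2)).
    by lra.
  move=> t /andP[t0 tle].
  have /(_ tau i) : subsidy_optimal P0 P1 r0 r1 (w s + t) (fun i => (i < s)%N).
    apply: threshold_optimal => j js.
      by have := Hhi j js; rewrite -/w; lra.
    by have := whittle_le js; rewrite -/w; lra.
  by rewrite !gE; lra.
(* Evaluate one of the two optimal policies; the other one attains the same Bellman maxima, so both
   actions are tight in [s]. *)
pose sigma (i : 'I_d) := (i < s.+1)%N.
have [g [h H]] := irreducible_poisson (subsidy_reward r0 r1 (w s) sigma)
    (kpol sigma) (@ipol sigma).
have Hb := optimal_bellman H opt1.
exists g, h; split=> // i si.
  by have := (bellman_optimal H Hb _).1 opt1 i; rewrite ltnS si.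
by have := (bellman_optimal H Hb _).1 opt2 i; rewrite ltnNge si.
Qed.

End SubsidyProblem.

(** * The N-bandit system *)

Section BanditSystem.
Variables (R : realType) (d N : nat) (P0 P1 : 'M[R]_d) (r0 r1 : 'I_d -> R).
Hypothesis SP0 : stochastic P0.
Hypothesis SP1 : stochastic P1.

Definition bandit_step (a : bool) (i j : 'I_d) : R := if a then P1 i j else P0 i j.

Lemma bandit_step_ge0 a i j : 0 <= bandit_step a i j.
Proof. by case: SP0 => p0 _; case: SP1 => p1 _; case: a; rewrite /bandit_step. Qed.

Lemma bandit_step_sum a i : \sum_j bandit_step a i j = 1.
Proof. by case: SP0 => _ p0; case: SP1 => _ p1; case: a; rewrite /bandit_step. Qed.

Lemma Ktrans_ge0 (x : gstate d N) a y : 0 <= Ktrans P0 P1 x a y.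
Proof. by apply: prodr_ge0 => n _; apply: bandit_step_ge0. Qed.

(** Independence of the bandits; total mass, one-bandit marginals and exponential moments all follow
    from it. *)
Lemma Ktrans_prod (x : gstate d N) a (F : 'I_N -> 'I_d -> R) :
  \sum_y Ktrans P0 P1 x a y * \prod_n F n (y n) =
  \prod_n \sum_j bandit_step (a n) (x n) j * F n j.
Proof. by rewrite bigA_distr_bigA; apply: eq_bigr => y _; rewrite -big_split. Qed.

Lemma Ktrans_sum1 (x : gstate d N) a : \sum_y Ktrans P0 P1 x a y = 1.
Proof.
transitivity (\sum_y Ktrans P0 P1 x a y * \prod_(n < N) 1).
  by apply: eq_bigr => y _; rewrite big1 ?mulr1.
rewrite (Ktrans_prod x a (fun _ _ => 1)); apply: big1 => n _.
by under eq_bigr do rewrite mulr1; apply: bandit_step_sum.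
Qed.

Lemma Ktrans_marginal (x : gstate d N) a n (f : 'I_d -> R) :
  \sum_y Ktrans P0 P1 x a y * f (y n) = \sum_j bandit_step (a n) (x n) j * f j.
Proof.
pose F m j := if m == n then f j else 1.
have FE (y : gstate d N) : f (y n) = \prod_m F m (y m).
  rewrite (bigD1 n) //= {1}/F eqxx big1 ?mulr1 // => m /negbTE mn.
  by rewrite /F mn.
under eq_bigr do rewrite FE.
rewrite Ktrans_prod (bigD1 n) //= [X in _ * X]big1 ?mulr1 => [|m /negbTE mn].
  by apply: eq_bigr => j _; rewrite /F eqxx.
by under eq_bigr do rewrite /F mn mulr1; apply: bandit_step_sum.
Qed.

Section Policy.
Variable pi : gstate d N -> gaction N -> R.
Hypothesis Hpi : is_policy pi.

Definition policy_kernel (x y : gstate d N) : R := \sum_a pi x a * Ktrans P0 P1 x a y.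

Definition policy_mean (f : gstate d N -> gaction N -> R) (x : gstate d N) : R :=
  \sum_a pi x a * f x a.

Lemma policy_kernelP : stochastic_kernel policy_kernel.
Proof.
case: Hpi => pi0 pi1; split=> [x y|x].
  by apply: sumr_ge0 => a _; rewrite mulr_ge0 // Ktrans_ge0.
rewrite /policy_kernel exchange_big /= -[RHS](pi1 x); apply: eq_bigr => a _.
by rewrite -mulr_sumr Ktrans_sum1 mulr1.
Qed.

Lemma kapp_policy f x :
  kapp policy_kernel f x = policy_mean (fun x a => \sum_y Ktrans P0 P1 x a y * f y) x.
Proof.
rewrite /kapp /policy_kernel /policy_mean.
under eq_bigr do rewrite mulr_suml.
rewrite exchange_big /=; apply: eq_bigr => a _; rewrite mulr_sumr.
by apply: eq_bigr => y _; rewrite mulrA.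
Qed.

Lemma sum_distr x0 t (f : gstate d N -> R) :
  \sum_x distr P0 P1 pi x0 t x * f x = iter t (kapp policy_kernel) f x0.
Proof.
elim: t f => [|t IH] f /=.
  rewrite (bigD1 x0) //= eqxx mul1r big1 ?addr0 // => x /negbTE ->.
  by rewrite mul0r.
rewrite -iterS iterSr -IH; under eq_bigr do rewrite mulr_suml.
rewrite exchange_big /=; apply: eq_bigr => x _.
by rewrite /kapp mulr_sumr; apply: eq_bigr => y _; rewrite mulrA.
Qed.

Lemma avg_rewardE x0 T :
  avg_reward P0 P1 r0 r1 pi x0 T = T%:R^-1 *
    \sum_(t < T) iter t (kapp policy_kernel) (policy_mean (greward r0 r1)) x0.
Proof.
by congr (_ * _); apply: eq_bigr => t _; rewrite /exp_reward -sum_distr.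
Qed.

Lemma avg_reward_cvg x0 : exists v : R, avg_reward P0 P1 r0 r1 pi x0 n @[n --> \oo] --> v.
Proof.
have [c [h [Kc rE]]] := mean_ergodic (policy_mean (greward r0 r1)) policy_kernelP.
exists (c x0); under [X in X @ _ --> _]eq_fun do rewrite avg_rewardE.
exact: cesaro_cvg policy_kernelP Kc rE.
Qed.

Variables (nu g : R) (h : 'I_d -> R).

Definition bellman_gap (i : 'I_d) (a : bool) : R :=
  g + h i - bellmanQ P0 P1 r0 r1 nu h i a.

Definition total_gap (x : gstate d N) (a : gaction N) : R :=
  \sum_n bellman_gap (x n) (a n).

(** Definition of the gap solved for the reward, bandit by bandit: the subsidy is paid to all
    bandits through [g] and [nu] is refunded for the active ones, which gives [g - nu] plus [nu] per
    activation. *)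
Lemma greward_bellman x : policy_mean (greward r0 r1) x =
  N%:R * (g - nu) + nu * policy_mean (fun _ => @nactive R N) x
  - policy_mean total_gap x
  + \sum_n h (x n) - kapp policy_kernel (fun y => \sum_n h (y n)) x.
Proof.
have [_ pi1] := Hpi.
have mean_cst c : c = \sum_a pi x a * c by rewrite -mulr_suml pi1 mul1r.
rewrite kapp_policy /policy_mean mulr_sumr.
rewrite (mean_cst (N%:R * (g - nu))) (mean_cst (\sum_n h (x n))).
rewrite -big_split -sumrB -big_split -sumrB /=; apply: eq_bigr => a _.
have -> : \sum_y Ktrans P0 P1 x a y * (\sum_n h (y n)) =
    \sum_n \sum_j bandit_step (a n) (x n) j * h j.
  under eq_bigr do rewrite mulr_sumr.
  by rewrite exchange_big /=; apply: eq_bigr => n _; rewrite Ktrans_marginal.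
have -> : N%:R * (g - nu) = \sum_(n < N) (g - nu) by rewrite sumr_const card_ord mulr_natl.
suff -> : greward r0 r1 x a = \sum_(n < N) (g - nu) + nu * nactive R a
   - total_gap x a + \sum_n h (x n) - \sum_n \sum_j bandit_step (a n) (x n) j * h j.
  by ring.
rewrite /nactive natr_sum mulr_sumr /total_gap -big_split -sumrB -big_split -sumrB /=.
apply: eq_bigr => n _; rewrite /bellman_gap /bellmanQ /bandit_step.
by case: (a n) => /=; ring.
Qed.

Lemma avg_reward_bellman x0 T : (0 < T)%N ->
  avg_reward P0 P1 r0 r1 pi x0 T =
  N%:R * (g - nu)
  + nu * (T%:R^-1 * \sum_(t < T) iter t (kapp policy_kernel)
                       (policy_mean (fun _ => @nactive R N)) x0)
  - T%:R^-1 * \sum_(t < T) iter t (kapp policy_kernel) (policy_mean total_gap) x0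
  + T%:R^-1 * (\sum_n h (x0 n)
               - iter T (kapp policy_kernel) (fun y => \sum_n h (y n)) x0).
Proof.
move=> T0; rewrite avg_rewardE.
pose H (x : gstate d N) := \sum_n h (x n).
pose D x := 0 + H x - kapp policy_kernel H x.
have K0 x : kapp policy_kernel (fun=> 0) x = 0 by rewrite (kapp_cst _ policy_kernelP).
have telescope := sum_iter_kapp T x0 K0 (fun x => erefl (D x)).
rewrite mulr0 add0r in telescope.
rewrite -[\sum_n h (x0 n)]/(H x0) -telescope.
(* Written as the average of itself, the constant allows the identity to be checked separately at
   each time. *)
have -> : N%:R * (g - nu) = T%:R^-1 * \sum_(t < T) iter t (kapp policy_kernel)
    (fun=> N%:R * (g - nu)) x0.
  under eq_bigr do rewrite (iter_kapp_cst _ _ policy_kernelP).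
  rewrite sumr_const card_ord -(mulr_natl (N%:R * (g - nu)) T) mulKf //.
  by rewrite pnatr_eq0 -lt0n.
rewrite mulrCA -mulrDr -mulrBr -mulrDr; congr (_ * _).
rewrite mulr_sumr -big_split -sumrB -big_split /=; apply: eq_bigr => t _.
pose A := policy_mean (fun _ => @nactive R N).
pose G := policy_mean total_gap.
have -> : policy_mean (greward r0 r1) =
    (fun x => N%:R * (g - nu) + nu * A x + -1 * G x + D x).
  by apply/funext => x; rewrite greward_bellman /D /H /A /G; ring.
rewrite (iter_kappD _ t (fun x => N%:R * (g - nu) + nu * A x + -1 * G x)).
rewrite (iter_kappD _ t (fun x => N%:R * (g - nu) + nu * A x)).
by rewrite (iter_kappD _ t (fun=> N%:R * (g - nu))) !iter_kappZ mulN1r.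
Qed.

End Policy.
End BanditSystem.

(** * Path law and activation constraint *)

Section PathLaw.
Variables (R : realType) (d N : nat) (P0 P1 : 'M[R]_d).
Hypothesis SP0 : stochastic P0.
Hypothesis SP1 : stochastic P1.
Variable pi : gstate d N -> gaction N -> R.
Hypothesis Hpi : is_policy pi.
Variable x0 : gstate d N.

Let S : finType := (gstate d N * gaction N)%type.

Lemma sum_pair (F : S -> R) : \sum_z F z = \sum_x \sum_a F (x, a).
Proof. by rewrite pair_bigA; apply: eq_bigr => -[]. Qed.

Definition path_ext L (p : {ffun 'I_L -> S}) (z : S) : {ffun 'I_L.+1 -> S} :=
  [ffun i => oapp p z (unlift ord_max i)].

Lemma path_ext_lt L (p : {ffun 'I_L -> S}) z t : (t < L)%N ->
  path_at x0 (path_ext p z) t = path_at x0 p t.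
Proof.
move=> tL; rewrite /path_at insubT /= => [|lt1]; first exact: ltnW.
rewrite insubT /= ffunE; case: unliftP => [j /(congr1 val)|/(congr1 val)] /=.
  rewrite /bump leqNgt ltn_ord add0n => E.
  by congr (p _); apply: val_inj.
by move=> E; exfalso; move: (tL); rewrite E ltnn.
Qed.

Lemma path_ext_last L (p : {ffun 'I_L -> S}) z : path_at x0 (path_ext p z) L = z.
Proof.
rewrite /path_at (insubT (fun i => (i < L.+1)%N) (ltnSn L)) /= ffunE.
case: unliftP => [j /(congr1 val)|] //=.
by rewrite /bump leqNgt ltn_ord add0n => E; exfalso; have := ltn_ord j; rewrite -E ltnn.
Qed.

Lemma sum_path_ext L (F : {ffun 'I_L.+1 -> S} -> R) :
  \sum_q F q = \sum_p \sum_z F (path_ext p z).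
Proof.
rewrite pair_big /=.
rewrite (reindex (fun pz : {ffun 'I_L -> S} * S => path_ext pz.1 pz.2)) //=.
exists (fun q : {ffun 'I_L.+1 -> S} => ([ffun j => q (lift ord_max j)], q ord_max)).
  move=> [p z] _ /=; congr (_, _); last by rewrite ffunE unlift_none.
  by apply/ffunP => j; rewrite !ffunE liftK.
move=> q _; apply/ffunP => i; rewrite ffunE /=.
by case: unliftP => [j ->|->] //=; rewrite ffunE.
Qed.

(** The conditional probability that the state-action pair [z] follows the path [p]. *)
Definition path_weight L (p : {ffun 'I_L -> S}) (z : S) : R :=
  (if L is L'.+1
   then Ktrans P0 P1 (path_at x0 p L').1 (path_at x0 p L').2 z.1
   else (z.1 == x0)%:R) * pi z.1 z.2.

Lemma path_prob_ext L (p : {ffun 'I_L -> S}) z :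
  path_prob P0 P1 pi x0 (path_ext p z) = path_prob P0 P1 pi x0 p * path_weight p z.
Proof.
rewrite /path_prob /path_weight big_ord_recr /= path_ext_last.
rewrite [X in _ * X = _]big_mkcond big_ord_recr /= ltnn mulr1.
have -> : \prod_(t < L) pi (path_at x0 (path_ext p z) t).1 (path_at x0 (path_ext p z) t).2
   = \prod_(t < L) pi (path_at x0 p t).1 (path_at x0 p t).2.
  by apply: eq_bigr => t _; rewrite path_ext_lt.
case: L p => [|L] p; first by rewrite path_ext_last !big_ord0; ring.
rewrite path_ext_lt // [X in _ = _ * X * _]big_mkcond [X in _ * X = _]big_ord_recr /=.
rewrite [X in _ = _ * X * _]big_ord_recr /= !ltnn leqnn mulr1.
rewrite path_ext_lt // path_ext_last.
set a := (X in _ * (X * _) = _); set b := (X in _ = _ * X * _).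
have -> : a = b; last by ring.
apply: eq_bigr => t _; have tL := ltn_ord t.
have -> : (t.+1 < L.+2)%N by rewrite !ltnS ltnW.
have -> : (t.+1 < L.+1)%N by rewrite ltnS.
by rewrite !path_ext_lt // ltnS // ltnW.
Qed.

Lemma path_prob_ge0 L (p : {ffun 'I_L -> S}) : 0 <= path_prob P0 P1 pi x0 p.
Proof.
rewrite /path_prob !mulr_ge0 //.
- by case: L p => [|L] p; rewrite ?ler0n.
- by apply: prodr_ge0 => t _; case: Hpi.
- by apply: prodr_ge0 => t _; apply: Ktrans_ge0.
Qed.

Lemma path_prob_eq0 L (p : {ffun 'I_L -> S}) (t : 'I_L) :
  pi (path_at x0 p t).1 (path_at x0 p t).2 = 0 -> path_prob P0 P1 pi x0 p = 0.
Proof. by move=> pit; rewrite /path_prob (bigD1 t) //= pit !(mul0r, mulr0). Qed.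

Lemma sum_path_weight L (p : {ffun 'I_L -> S}) : \sum_z path_weight p z = 1.
Proof.
case: Hpi => _ pi1; rewrite sum_pair.
transitivity (\sum_x (if L is L'.+1
   then Ktrans P0 P1 (path_at x0 p L').1 (path_at x0 p L').2 x
   else (x == x0)%:R) : R).
  by apply: eq_bigr => x _; rewrite /path_weight /= -mulr_sumr pi1 mulr1.
case: L p => [|L] p; last exact: Ktrans_sum1.
by rewrite (bigD1 x0) //= eqxx big1 ?addr0 // => x /negbTE ->.
Qed.

(** Consistency of the path laws: the last step integrates out to 1. *)
Lemma sum_path_prob_take L (f : {ffun 'I_L -> S} -> R) :
  \sum_p \sum_z path_prob P0 P1 pi x0 (path_ext p z) * f p =
  \sum_p path_prob P0 P1 pi x0 p * f p.
Proof.
apply: eq_bigr => p _; rewrite -mulr_suml; congr (_ * _).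
under eq_bigr do rewrite path_prob_ext.
by rewrite -mulr_sumr sum_path_weight mulr1.
Qed.

Lemma sum_path_prob L : \sum_(p : {ffun 'I_L -> S}) path_prob P0 P1 pi x0 p = 1.
Proof.
elim: L => [|L IH]; last first.
  rewrite sum_path_ext -IH; apply: eq_bigr => p _.
  under eq_bigr do rewrite path_prob_ext.
  by rewrite -mulr_sumr sum_path_weight mulr1.
transitivity (\sum_(p : {ffun 'I_0 -> S}) (1 : R)).
  by apply: eq_bigr => p _; rewrite /path_prob !big_ord0 !mul1r.
by rewrite sumr_const card_ffun card_ord expn0.
Qed.

Lemma path_marginal_last L (f : gstate d N -> gaction N -> R) :
  \sum_(p : {ffun 'I_L.+1 -> S})
     path_prob P0 P1 pi x0 p * f (path_at x0 p L).1 (path_at x0 p L).2 =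
  iter L (kapp (policy_kernel P0 P1 pi)) (policy_mean pi f) x0.
Proof.
elim: L f => [|L IH] f; rewrite sum_path_ext.
  transitivity (\sum_(p : {ffun 'I_0 -> S}) policy_mean pi f x0); last first.
    by rewrite sumr_const card_ffun card_ord expn0.
  apply: eq_bigr => p _; rewrite /policy_mean.
  rewrite sum_pair /=.
  rewrite (bigD1 x0) //= [X in _ + X]big1 ?addr0 => [|x /negbTE xx0].
    apply: eq_bigr => a _; rewrite path_prob_ext path_ext_last /path_weight /= eqxx.
    by rewrite /path_prob !big_ord0 /=; ring.
  by apply: big1 => a _; rewrite path_prob_ext /path_weight /= xx0 mul0r mulr0 mul0r.
rewrite iterSr (funext (kapp_policy _ _ _ _)) -IH; apply: eq_bigr => p _.
rewrite mulr_sumr.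
rewrite sum_pair /=.
apply: eq_bigr => x _; rewrite /policy_mean !mulr_sumr; apply: eq_bigr => a _.
by rewrite path_prob_ext path_ext_last /path_weight /=; ring.
Qed.

Lemma path_marginal L t (f : gstate d N -> gaction N -> R) : (t < L)%N ->
  \sum_(p : {ffun 'I_L -> S})
     path_prob P0 P1 pi x0 p * f (path_at x0 p t).1 (path_at x0 p t).2 =
  iter t (kapp (policy_kernel P0 P1 pi)) (policy_mean pi f) x0.
Proof.
elim: L => // L IH; rewrite ltnS leq_eqVlt => /orP[/eqP->|tL].
  exact: path_marginal_last.
rewrite sum_path_ext -IH // -sum_path_prob_take.
by apply: eq_bigr => p _; apply: eq_bigr => z _; rewrite path_ext_lt.
Qed.

Lemma nactive_ge0 (a : gaction N) : 0 <= nactive R a.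
Proof. exact: ler0n. Qed.

Lemma nactive_le (a : gaction N) : nactive R a <= N%:R.
Proof.
rewrite ler_nat -[X in (_ <= X)%N]card_ord -sum1_card; apply: leq_sum => n _.
by case: (a n).
Qed.

(** Bounded convergence: the deviation of the average activation from [c] is at most [e / 2] off an
    event of probability at most [e / 2 / B], and at most [B] on it. *)
Lemma activation_limit_mean c e : as_activation_limit P0 P1 pi x0 c -> 0 < e ->
  exists T0, forall L, (T0 <= L)%N ->
  `|L%:R^-1 * \sum_(t < L) iter t (kapp (policy_kernel P0 P1 pi))
       (policy_mean pi (fun _ => @nactive R N)) x0 - c| <= e.
Proof.
move=> Hlim e0.
pose B : R := N%:R + `|c| + 1.
have B0 : 0 < B by rewrite ltr_wpDl // addr_ge0 // ler0n.
have [T [T1 HT]] := Hlim (e / 2) (e / 2 / B) (divr_gt0 e0 (ltr0Sn _ 1))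
  (divr_gt0 (divr_gt0 e0 (ltr0Sn _ 1)) B0).
exists T => L TL.
pose X (p : {ffun 'I_L -> S}) := L%:R^-1 * \sum_(t < L) nactive R (path_at x0 p t).2 - c.
have L0 : (0 < L%:R :> R) by rewrite ltr0n (leq_trans T1).
have XB p : `|X p| <= B.
  apply: (le_trans (ler_normB _ _)); rewrite /B -addrA lerD //; last by rewrite lerDl.
  rewrite ger0_norm; last first.
    apply: mulr_ge0; first by rewrite invr_ge0 ltW.
    by apply: sumr_ge0 => t _; apply: nactive_ge0.
  rewrite mulrC ler_pdivrMr //.
  apply: (@le_trans _ _ (\sum_(t < L) N%:R)).
    by apply: ler_sum => t _; apply: nactive_le.
  by rewrite sumr_const card_ord -(mulr_natr (N%:R : R) L).
have Xe p : ~~ dev_event x0 c (e / 2) T p -> `|X p| <= e / 2.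
  move=> /existsPn /(_ ord_max); rewrite TL /= -leNgt; exact.
have -> : L%:R^-1 * \sum_(t < L) iter t (kapp (policy_kernel P0 P1 pi))
    (policy_mean pi (fun _ => @nactive R N)) x0 - c =
    \sum_p path_prob P0 P1 pi x0 p * X p.
  under [RHS]eq_bigr do rewrite mulrBr.
  rewrite sumrB -mulr_suml sum_path_prob mul1r; congr (_ - _).
  under [RHS]eq_bigr do rewrite mulrCA mulr_sumr.
  rewrite -mulr_sumr exchange_big /=; congr (_ * _); apply: eq_bigr => t _.
  by rewrite (path_marginal (fun _ => @nactive R N) (ltn_ord t)).
apply: le_trans (ler_norm_sum _ _ _) _.
under eq_bigr => p _ do rewrite normrM (ger0_norm (path_prob_ge0 p)).
pose ev (p : {ffun 'I_L -> S}) := dev_event x0 c (e / 2) T p.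
rewrite (bigID ev) /=.
have -> : e = e / 2 + e / 2 by field.
apply: lerD.
  apply: (@le_trans _ _ ((\sum_(p | ev p)
     path_prob P0 P1 pi x0 p) * B)); last by rewrite -ler_pdivlMr // HT.
  rewrite mulr_suml; apply: ler_sum => p _.
  by rewrite ler_wpM2l // path_prob_ge0.
rewrite -[leRHS]mul1r -[X in _ <= X * _](sum_path_prob L) mulr_suml.
rewrite [leRHS](bigID ev) /= ler_wpDl //.
  by apply: sumr_ge0 => p _; rewrite mulr_ge0 ?path_prob_ge0 // divr_ge0 // ltW.
by apply: ler_sum => p dp; rewrite ler_wpM2l ?path_prob_ge0 // Xe.
Qed.

End PathLaw.

(** * Whittle index priority and the mean-field map *)

Section WhittlePriority.
Variables (R : realType) (d N : nat) (nu : 'I_d -> R) (x : gstate d N).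
Hypothesis Hnu : forall i j : 'I_d, (i < j)%N -> nu j < nu i.

Definition priority (m n : 'I_N) : bool := (x m < x n)%N || ((x m == x n) && (m < n)%N).

Definition priority_rank (n : 'I_N) : nat := #|[pred m | priority m n]|.

Lemma wip_actionE k n : wip_action nu k x n = (priority_rank n < k)%N.
Proof.
rewrite ffunE /priority_rank; congr (_ < k)%N; apply: eq_card => m.
have E : (nu (x n) < nu (x m)) || (nu (x m) == nu (x n)) && (m < n)%N = priority m n;
  last by rewrite inE -E; apply/idP/idP; rewrite in_setE.
rewrite /priority; have [lt|gt|eq] := ltngtP (x m) (x n).
- by rewrite Hnu.
- rewrite -val_eqE (gtn_eqF gt) /=.
  by rewrite ltNge (ltW (Hnu gt)) (lt_eqF (Hnu gt)).
- by have -> : x m = x n by [apply: val_inj]; rewrite ltxx !eqxx.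
Qed.

Lemma priority_trans : transitive priority.
Proof.
move=> b a c; rewrite /priority -!val_eqE /=; lia.
Qed.

Lemma priority_total m n : m != n -> priority m n || priority n m.
Proof. by rewrite /priority -!val_eqE /=; lia. Qed.

Lemma priority_irr n : priority n n = false.
Proof. by rewrite /priority !ltnn andbF. Qed.

Lemma ltn_priority_rank m n : priority m n -> (priority_rank m < priority_rank n)%N.
Proof.
move=> mn; apply: proper_card; apply/properP; split.
  by apply/fintype.subsetP => l; rewrite !inE => /priority_trans; apply.
by exists m; rewrite !inE ?mn ?priority_irr.
Qed.

Lemma priority_rank_inj : injective priority_rank.
Proof.
move=> m n E; apply/eqP/negPn/negP => /priority_total /orP[]/ltn_priority_rank;
  by rewrite E ltnn.
Qed.

Lemma priority_rank_lt n : (priority_rank n < N)%N.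
Proof.
rewrite -[X in (_ < X)%N]card_ord; apply: proper_card.
by apply/properP; split; [apply/fintype.subsetP => m|exists n; rewrite !inE ?priority_irr].
Qed.

Definition occupation (c : nat) : nat := #|[pred n | (x n < c)%N]|.

(** Bandits in the states below [c] precede all others, so they fill exactly the first
    [occupation c] ranks. *)
Lemma priority_rank_occupation n c : (priority_rank n < occupation c)%N = (x n < c)%N.
Proof.
apply/idP/idP => [|xc]; last first.
  apply: proper_card; apply/properP; split; last first.
    by exists n; rewrite !inE ?priority_irr.
  apply/fintype.subsetP => m; rewrite !inE /priority -val_eqE /=; lia.
apply: contraTT; rewrite -!leqNgt => cx; apply: subset_leq_card.
by apply/fintype.subsetP => m; rewrite !inE /priority; lia.
Qed.

(** Ranks are injective and below [N], hence a permutation of the [N] positions. *)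
Lemma card_priority_rank_lt c : (c <= N)%N -> #|[pred n | (priority_rank n < c)%N]| = c.
Proof.
move=> cN.
pose f n := Ordinal (priority_rank_lt n).
have fi : injective f by move=> m n [] /priority_rank_inj.
have -> : #|[pred n | (priority_rank n < c)%N]| = #|[preim f of [pred i : 'I_N | (i < c)%N]]|.
  by apply: eq_card.
have wi : injective (widen_ord cN) by move=> a b /(congr1 val) /= ab; exact: val_inj.
rewrite card_preim // -[RHS]card_ord -(fintype.card_image wi).
apply: eq_card => i; apply/andP/fintype.imageP => [[_ ic]|[j _ ->]].
  by exists (Ordinal (ic : (i < c)%N)) => //; apply: val_inj.
by split; [exact: inj_card_onto|exact: (ltn_ord j)].
Qed.

Lemma wip_count k c : (k <= N)%N ->
  #|[pred n | wip_action nu k x n && (x n < c)%N]| = minn k (occupation c).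
Proof.
move=> kN; rewrite -[RHS]card_priority_rank_lt ?geq_min ?kN //.
by apply: eq_card => n; rewrite !inE wip_actionE -priority_rank_occupation leq_min.
Qed.

Lemma nactive_wip k : (k <= N)%N -> nactive R (wip_action nu k x) = k%:R.
Proof.
move=> kN; rewrite /nactive; congr (_%:R).
(* Every state is below [d], so the condition on the state drops out. *)
have := wip_count d kN.
have -> : occupation d = N.
  rewrite /occupation -[RHS]card_ord; apply: eq_card => n.
  by rewrite !inE ltn_ord.
rewrite (minn_idPl kN) => H; apply: etrans H; rewrite -sum1_card [RHS]big_mkcond /=.
apply: eq_bigr => n _.
by rewrite inE ltn_ord andbT; case: (fun_of_fin _ n).
Qed.

End WhittlePriority.

(** * The mean-field map as a Lipschitz self-map of the simplex *)

Section MeanField.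
Variables (R : realType) (d : nat) (P0 P1 : 'M[R]_d) (alpha : R).
Hypothesis SP0 : stochastic P0.
Hypothesis SP1 : stochastic P1.
Hypothesis Halpha : 0 < alpha < 1.

Definition cumul (m : 'I_d -> R) (c : nat) : R := \sum_(i < d | (i < c)%N) m i.

Lemma cumul0 m : cumul m 0 = 0.
Proof. by rewrite /cumul big_pred0. Qed.

Lemma cumulS m (i : 'I_d) : cumul m i.+1 = cumul m i + m i.
Proof.
rewrite /cumul (bigD1 i) //= addrC; congr (_ + _); apply: eq_bigl => j.
by rewrite -val_eqE /=; lia.
Qed.

Lemma cumul_all m : cumul m d = \sum_i m i.
Proof. by apply: eq_bigl => i; rewrite ltn_ord. Qed.

Lemma ler_cumul m a b : (forall i, 0 <= m i) -> (a <= b)%N -> cumul m a <= cumul m b.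
Proof.
move=> m0 ab; rewrite /cumul [leRHS](bigID (fun i : 'I_d => (i < a)%N)) /=.
rewrite (eq_bigl (fun i : 'I_d => (i < b)%N && (i < a)%N)).
  by rewrite lerDl sumr_ge0.
by move=> i; lia.
Qed.

(* The mass of state i that is activated: the budget alpha is spent in
   increasing order of the states. *)
Definition active_mass (m : 'I_d -> R) (i : 'I_d) : R :=
  Num.min alpha (cumul m i.+1) - Num.min alpha (cumul m i).

(** A form of [phi] without case distinction on the state where the budget runs out; Lipschitz
    continuity across changes of that state becomes visible. *)
Definition phi_mass (m : 'I_d -> R) (j : 'I_d) : R :=
  \sum_i (active_mass m i * P1 i j + (m i - active_mass m i) * P0 i j).

(** On the simplex the default value in [s_of] never occurs: [s] precedes the least [c] with
    [alpha < cumul m c], which exists because [alpha < 1] and is not 0 because [alpha > 0]. *)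
Lemma s_ofP m : simplex m -> exists s : 'I_d,
  s_of alpha m = s /\ cumul m s <= alpha < cumul m s.+1.
Proof.
case=> m01 m1; rewrite /s_of; case: pickP => [s /andP[a b]|none] /=.
  by exists s; rewrite /cumul a b.
have ex : exists c, alpha < cumul m c.
  by exists d; rewrite cumul_all m1; case/andP: Halpha.
case: (ex_minnP ex) => -[|c] ac cmin.
  by case/andP: Halpha => a0 _; move: ac; rewrite cumul0 ltNge ltW.
have ca : cumul m c <= alpha.
  by rewrite leNgt; apply/negP => /cmin; rewrite ltnn.
have cd : (c < d)%N.
  rewrite ltnNge; apply/negP => dc.
  have : cumul m c.+1 = cumul m c.
    by apply: eq_bigl => i; have := ltn_ord i; lia.
  by move=> E; move: ac; rewrite E ltNge ca.
by have := none (Ordinal cd); rewrite /= -/(cumul m c) -/(cumul m c.+1) ca ac.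
Qed.

Lemma phiE m : simplex m -> phi P0 P1 alpha m = phi_mass m.
Proof.
move=> ms; have m0 i : 0 <= m i by case: ms => /(_ i)/andP[].
have [s [sE /andP[sa as_]]] := s_ofP ms.
apply/funext => j; rewrite /phi sE /phi_mass -/(cumul m s) -/(cumul m s.+1).
rewrite big_mkcond [X in _ + X + _]big_mkcond [X in _ + _ + X]big_mkcond.
rewrite -!big_split /=; apply: eq_bigr => i _; rewrite /active_mass.
(* States before [s] are fully active, states after it fully passive, and [s] receives the rest of
   the budget. *)
have [lt|gt|/val_inj ->] := ltngtP i s.
- have c1 := ler_cumul m0 lt; have c2 := ler_cumul m0 (ltnW lt).
  rewrite (min_idPr _) ?(min_idPr _) ?(le_trans c1) ?(le_trans c2) //.
  by rewrite cumulS; ring.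
- have c1 := ler_cumul m0 gt; have c2 := ler_cumul m0 (ltnW gt).
  have c3 := ler_cumul m0 (leqnSn i).
  rewrite (min_idPl _) ?(min_idPl _); [by ring|lra|lra].
rewrite (min_idPl (ltW as_)) (min_idPr sa) cumulS; ring.
Qed.

Lemma active_mass_bounds m i : (forall i, 0 <= m i) -> 0 <= active_mass m i <= m i.
Proof.
move=> m0; rewrite /active_mass cumulS; have := m0 i.
set c := cumul m i; move: (m i) => y y0.
rewrite !minEle; have [h1|h1] := leP alpha (c + y); have [h2|h2] := leP alpha c;
  by apply/andP; split; lra.
Qed.

Lemma phi_simplex m : simplex m -> simplex (phi P0 P1 alpha m).
Proof.
move=> ms; rewrite phiE //; have m0 i : 0 <= m i by case: ms => /(_ i)/andP[].
have [p00 p01] := SP0; have [p10 p11] := SP1.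
have ge0 j : 0 <= phi_mass m j.
  apply: sumr_ge0 => i _; have /andP[a b] := active_mass_bounds i m0.
  by rewrite addr_ge0 // mulr_ge0 // subr_ge0.
have sum1 : \sum_j phi_mass m j = 1.
  case: ms => _ <-; rewrite exchange_big; apply: eq_bigr => i _.
  by rewrite big_split /= -!mulr_sumr p01 p11; ring.
split=> // j; rewrite ge0 -sum1 (bigD1 j) //= lerDl.
by apply: sumr_ge0 => i _.
Qed.

Lemma Phi_simplex t m : simplex m -> simplex (Phi P0 P1 alpha t m).
Proof. by move=> ms; elim: t => //= t; apply: phi_simplex. Qed.

Definition sup_close (delta : R) (m m' : 'I_d -> R) : bool :=
  [forall i, `|m i - m' i| <= delta].

Lemma sup_closeP delta m m' : reflect (forall i, `|m i - m' i| <= delta) (sup_close delta m m').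
Proof. exact: forallP. Qed.

Lemma sup_close_trans a b m1 m2 m3 :
  sup_close a m1 m2 -> sup_close b m2 m3 -> sup_close (a + b) m1 m3.
Proof.
move=> /sup_closeP h1 /sup_closeP h2; apply/sup_closeP => i.
have -> : m1 i - m3 i = (m1 i - m2 i) + (m2 i - m3 i) by ring.
by rewrite (le_trans (ler_normD _ _)) // lerD.
Qed.

Lemma cumul_close delta m m' c : 0 <= delta -> sup_close delta m m' ->
  `|cumul m c - cumul m' c| <= d%:R * delta.
Proof.
move=> d0 /sup_closeP cl; rewrite /cumul -sumrB.
apply: le_trans (ler_norm_sum _ _ _) _.
apply: (@le_trans _ _ (\sum_(i < d) delta)); last first.
  by rewrite sumr_const card_ord mulr_natl.
by rewrite big_mkcond; apply: ler_sum => i _; case: ifP.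
Qed.

Lemma min_dist (a b c : R) : `|Num.min a b - Num.min a c| <= `|b - c|.
Proof.
rewrite !minEle; have [h1|h1] := leP a b; have [h2|h2] := leP a c => //;
  rewrite ?subrr ?normr0 //.
- rewrite ger0_norm ?ger0_norm; lra.
- rewrite ler0_norm ?ler0_norm; lra.
Qed.

(** Each of the [d] summands of [phi_mass] moves by at most [(4 d + 1) delta]: the active mass moves
    by [2 d delta] and occurs twice, the mass itself by [delta]. *)
Definition phi_lip : R := d%:R * (4 * d%:R + 1).

Lemma phi_close delta m m' : simplex m -> simplex m' -> 0 <= delta ->
  sup_close delta m m' ->
  sup_close (phi_lip * delta) (phi P0 P1 alpha m) (phi P0 P1 alpha m').
Proof.
move=> ms ms' d0 cl; rewrite !phiE //; apply/sup_closeP => j.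
have [p00 p01] := SP0; have [p10 p11] := SP1.
have P0b i : P0 i j <= 1 by rewrite -(p01 i) (bigD1 j) //= lerDl sumr_ge0.
have P1b i : P1 i j <= 1 by rewrite -(p11 i) (bigD1 j) //= lerDl sumr_ge0.
rewrite /phi_mass -sumrB; apply: le_trans (ler_norm_sum _ _ _) _.
rewrite /phi_lip -mulrA.
apply: (@le_trans _ _ (\sum_(i < d) ((4 * d%:R + 1) * delta))); last first.
  by rewrite sumr_const card_ord -[leLHS]mulr_natl.
apply: ler_sum => i _.
have a1 : `|active_mass m i - active_mass m' i| <= 2 * (d%:R * delta).
  rewrite /active_mass.
  have -> (a b c e : R) : a - b - (c - e) = (a - c) - (b - e) by ring.
  have c1 := le_trans (min_dist alpha _ _) (cumul_close i d0 cl).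
  have c2 := le_trans (min_dist alpha _ _) (cumul_close i.+1 d0 cl).
  by apply: le_trans (ler_normB _ _) _; lra.
have a2 := (sup_closeP _ _ _ cl) i.
have -> : active_mass m i * P1 i j + (m i - active_mass m i) * P0 i j -
    (active_mass m' i * P1 i j + (m' i - active_mass m' i) * P0 i j) =
    (active_mass m i - active_mass m' i) * P1 i j
    + ((m i - m' i) * P0 i j - (active_mass m i - active_mass m' i) * P0 i j) by ring.
have n1 (z p : R) : 0 <= p -> p <= 1 -> `|z * p| <= `|z|.
  by move=> p0 p1; rewrite normrM (ger0_norm p0) ler_piMr.
apply: le_trans (ler_normD _ _) _.
have := n1 (active_mass m i - active_mass m' i) _ (p10 i j) (P1b i).
have := n1 (active_mass m i - active_mass m' i) _ (p00 i j) (P0b i).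
have := n1 (m i - m' i) _ (p00 i j) (P0b i).
have := ler_normB ((m i - m' i) * P0 i j) ((active_mass m i - active_mass m' i) * P0 i j).
lra.
Qed.

End MeanField.

(** * Concentration around the mean-field trajectory *)

Section Concentration.
Variables (R : realType) (d N : nat) (P0 P1 : 'M[R]_d).
Hypothesis SP0 : stochastic P0.
Hypothesis SP1 : stochastic P1.

(** From [expR z * (1 - z) <= 1], since [(1 - z) * (1 + z + 2 z^2) = 1 + z^2 (1 - 2 z)] is at least
    1 here. *)
Lemma expR_le_quadratic (z : R) : z <= 2^-1 -> expR z <= 1 + z + 2 * z ^+ 2.
Proof.
move=> z1; have := expR_ge1Dx (- z); rewrite expRN => h.
have e0 := expR_gt0 z.
have h2 : expR z * (1 - z) <= 1.
  by rewrite -ler_pdivlMl // mulr1.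
nra.
Qed.

(** By independence the moment generating function factorises; a centred Bernoulli factor is at most
    [expR (p * (expR z - 1 - z))], hence at most [expR (2 * z ^+ 2)]. *)
Lemma chernoff (x : gstate d N) (a : gaction N) (j : 'I_d) (z : R) :
  `|z| <= 2^-1 ->
  \sum_y Ktrans P0 P1 x a y *
    expR (z * (\sum_n (y n == j)%:R - \sum_n bandit_step P0 P1 (a n) (x n) j))
  <= expR (2 * z ^+ 2 * N%:R).
Proof.
move=> z1; pose p n := bandit_step P0 P1 (a n) (x n) j.
pose F (n : 'I_N) (i : 'I_d) := expR (z * ((i == j)%:R - p n)).
under eq_bigr => y _ do rewrite -sumrB mulr_sumr expR_sum.
rewrite (Ktrans_prod P0 P1 x a F).
have -> : 2 * z ^+ 2 * N%:R = \sum_(n < N) (2 * z ^+ 2).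
  by rewrite sumr_const card_ord mulr_natr.
rewrite expR_sum; apply: ler_prod => n _; apply/andP; split.
  by apply: sumr_ge0 => i _; rewrite mulr_ge0 ?bandit_step_ge0 // expR_ge0.
have p0 : 0 <= p n by apply: bandit_step_ge0.
have -> : \sum_i bandit_step P0 P1 (a n) (x n) i * F n i =
    expR (- (z * p n)) * (1 + p n * (expR z - 1)).
  have FE i : F n i = expR (- (z * p n)) * (1 + (i == j)%:R * (expR z - 1)).
    rewrite /F mulrBr expRD mulrC; congr (_ * _).
    by case: eqP => _; rewrite ?mulr1 ?mulr0 ?mul1r ?mul0r ?expR0; ring.
  transitivity (expR (- (z * p n)) * \sum_i (bandit_step P0 P1 (a n) (x n) i
      + (i == j)%:R * (bandit_step P0 P1 (a n) (x n) i * (expR z - 1)))).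
    by rewrite mulr_sumr; apply: eq_bigr => i _; rewrite FE; ring.
  rewrite big_split /= bandit_step_sum //; congr (_ * (1 + _)).
  rewrite (bigD1 j) //= eqxx mul1r big1 ?addr0 // => i /negbTE ->.
  by rewrite mul0r.
apply: (@le_trans _ _ (expR (- (z * p n)) * expR (p n * (expR z - 1)))).
  by rewrite ler_wpM2l ?expR_ge0 // expR_ge1Dx.
rewrite -expRD ler_expR.
have zz : z <= 2^-1 by apply: le_trans (ler_norm z) z1.
have p1 : p n <= 1.
  rewrite -(bandit_step_sum SP0 SP1 (a n) (x n)) (bigD1 j) //= lerDl.
  by apply: sumr_ge0 => i _; apply: bandit_step_ge0.
have := expR_le_quadratic zz; have := sqr_ge0 z.
nra.
Qed.

Definition config (x : gstate d N) (i : 'I_d) : R := N%:R^-1 * \sum_n (x n == i)%:R.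

Variables (nu : 'I_d -> R) (alpha : R) (k : nat).
Hypothesis Hnu : forall i j : 'I_d, (i < j)%N -> nu j < nu i.
Hypothesis Halpha : 0 < alpha < 1.
Hypothesis Hk : alpha * N%:R = k%:R.
Hypothesis HN : (0 < N)%N.

Lemma budget_le : (k <= N)%N.
Proof.
by rewrite -(ler_nat R) -Hk ler_piMl ?ler0n //; case/andP: Halpha => _ /ltW.
Qed.

Let N0 : (N%:R : R) != 0.
Proof. by rewrite pnatr_eq0 -lt0n. Qed.

Lemma natr_card (I : finType) (p : pred I) :
  (#|[pred n | p n]|%:R : R) = \sum_n (p n)%:R.
Proof.
rewrite -sum1_card natr_sum big_mkcond; apply: eq_bigr => n _.
by rewrite inE; case: (p n).
Qed.

Lemma config_simplex x : simplex (config x).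
Proof.
have ge0 i : 0 <= config x i.
  by rewrite mulr_ge0 ?invr_ge0 ?ler0n // sumr_ge0 // => n _; rewrite ler0n.
have sum1 : \sum_i config x i = 1.
  rewrite -mulr_sumr exchange_big /=.
  transitivity (N%:R^-1 * \sum_(n < N) (1 : R)).
    congr (_ * _); apply: eq_bigr => n _.
    by rewrite (bigD1 (x n)) //= eqxx big1 ?addr0 // => i; rewrite eq_sym => /negbTE ->.
  by rewrite sumr_const card_ord mulVf.
split=> // i; rewrite ge0 -sum1 (bigD1 i) //= lerDl.
by apply: sumr_ge0 => j _.
Qed.

Lemma cumul_config x c : N%:R * cumul (config x) c = (occupation x c)%:R.
Proof.
rewrite natr_card /cumul -mulr_sumr mulrA mulfV // mul1r exchange_big /=.
apply: eq_bigr => n _; case: ltnP => xc.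
  rewrite (bigD1 (x n)) //= eqxx big1 ?addr0 // => i /andP[_].
  by rewrite eq_sym => /negbTE ->.
by rewrite big1 // => i ic; case: eqP => // E; move: ic; rewrite -E ltnNge xc.
Qed.

Lemma min_cumul_config x c : N%:R * Num.min alpha (cumul (config x) c) =
  \sum_n (wip_action nu k x n && (x n < c)%N)%:R.
Proof.
rewrite -natr_card (wip_count _ Hnu) ?budget_le // minr_pMr ?ler0n //.
rewrite cumul_config mulrC Hk.
by rewrite minEle ler_nat minnE; case: leqP => h; congr (_%:R); lia.
Qed.

Lemma active_mass_config x i : N%:R * active_mass alpha (config x) i =
  \sum_n (wip_action nu k x n && (x n == i))%:R.
Proof.
rewrite /active_mass mulrBr !min_cumul_config -sumrB; apply: eq_bigr => n _.
rewrite ltnS leq_eqVlt val_eqE.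
case: (wip_action nu k x n) => /=; last by rewrite subrr.
have [->|_] := eqVneq; first by rewrite ltnn subr0.
by rewrite subrr.
Qed.

(** As the budget is the integer [k], the mean-field map is exactly the mean next configuration
    under WIP for finite [N], with no rounding error. *)
Lemma mean_config x j :
  \sum_n bandit_step P0 P1 (wip_action nu k x n) (x n) j =
  N%:R * phi P0 P1 alpha (config x) j.
Proof.
rewrite (phiE P0 P1 Halpha (config_simplex x)) mulr_sumr.
transitivity (\sum_n \sum_i ((wip_action nu k x n && (x n == i))%:R * P1 i j
   + ((x n == i)%:R - (wip_action nu k x n && (x n == i))%:R) * P0 i j)).
  apply: eq_bigr => n _; rewrite (bigD1 (x n)) //= eqxx andbT big1 => [|i].
    by rewrite /bandit_step addr0; case: (wip_action nu k x n) => /=; ring.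
  by rewrite eq_sym => /negbTE ->; rewrite andbF subrr !mul0r addr0.
rewrite exchange_big; apply: eq_bigr => i _.
have -> (c u v w z : R) : c * (u * v + (w - u) * z) = c * u * v + (c * w - c * u) * z by ring.
rewrite active_mass_config /config mulrA mulfV // mul1r.
by rewrite big_split /= -!mulr_suml sumrB.
Qed.

Lemma one_step_concentration x delta : 0 < delta <= 1 ->
  \sum_y Ktrans P0 P1 x (wip_action nu k x) y *
     (~~ sup_close delta (config y) (phi P0 P1 alpha (config x)))%:R
  <= 2 * d%:R * expR (- (delta ^+ 2 / 8 * N%:R)).
Proof.
move=> /andP[d0 d1]; set a := wip_action nu k x.
pose D (j : 'I_d) (y : gstate d N) := \sum_n (y n == j)%:R - \sum_n bandit_step P0 P1 (a n) (x n) j.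
(* Exponential Markov bound with [z] equal to plus or minus [delta / 4], the minimiser of
   [2 z^2 - |z| delta]; the minimum [- delta^2 / 8] is the final rate. The factor [2 d] counts the
   signs and the coordinates. *)
pose E z (j : 'I_d) y := expR (- (delta / 4 * (delta * N%:R))) * expR (z * D j y).
have NR : (0 : R) < N%:R by rewrite ltr0n.
have DE j y : D j y = N%:R * (config y j - phi P0 P1 alpha (config x) j).
  by rewrite /D mean_config mulrBr /config mulrA mulfV // mul1r.
have E0 z j y : 0 <= E z j y by rewrite mulr_ge0 ?expR_ge0.
have bound y : (~~ sup_close delta (config y) (phi P0 P1 alpha (config x)))%:R <=
    \sum_j (E (delta / 4) j y + E (- (delta / 4)) j y).
  have S0 : 0 <= \sum_j (E (delta / 4) j y + E (- (delta / 4)) j y).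
    by apply: sumr_ge0 => j _; rewrite addr_ge0.
  have [//|/forallPn[j]] := boolP (sup_close _ _ _).
  rewrite -ltNge => far; rewrite (bigD1 j) //=; apply: ler_wpDr.
    by apply: sumr_ge0 => i _; rewrite addr_ge0.
  have far' : delta * N%:R <= `|D j y|.
    by rewrite DE normrM (ger0_norm (ltW NR)) mulrC ler_pM2l // ltW.
  have dl : 0 < delta / 4 by rewrite divr_gt0.
  have one z : delta / 4 * (delta * N%:R) <= z * D j y -> 1 <= E z j y.
    by move=> h; rewrite /E -expRD -[leLHS]expR0 ler_expR; lra.
  have [Dj|Dj] := leP 0 (D j y).
    apply: ler_wpDr => //; apply: one; rewrite ler_pM2l //.
    by rewrite (ger0_norm Dj) in far'.
  apply: ler_wpDl => //; apply: one; rewrite mulNr -mulrN ler_pM2l //.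
  by rewrite (ltr0_norm Dj) in far'.
apply: (@le_trans _ _ (\sum_y Ktrans P0 P1 x a y *
    \sum_j (E (delta / 4) j y + E (- (delta / 4)) j y))).
  by apply: ler_sum => y _; apply: ler_wpM2l => //; apply: Ktrans_ge0.
under eq_bigr do rewrite mulr_sumr.
rewrite exchange_big /=.
have EK z j : z ^+ 2 = (delta / 4) ^+ 2 -> `|z| <= 2^-1 ->
    \sum_y Ktrans P0 P1 x a y * E z j y <= expR (- (delta ^+ 2 / 8 * N%:R)).
  move=> z2 z1; under eq_bigr do rewrite /E mulrCA.
  rewrite -mulr_sumr.
  apply: le_trans (ler_wpM2l (expR_ge0 _) (chernoff x a j z1)) _.
  rewrite -expRD ler_expR z2 le_eqVlt; apply/orP; left; apply/eqP.
  by field.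
apply: (@le_trans _ _ (\sum_(j < d) (2 * expR (- (delta ^+ 2 / 8 * N%:R))))).
  apply: ler_sum => j _; under eq_bigr do rewrite mulrDr.
  rewrite big_split /= mulr2n mulrDl mul1r.
  have nb : `|delta / 4| <= 2^-1 by rewrite ger0_norm ?divr_ge0 ?ltW //; lra.
  by apply: lerD; apply: EK; rewrite ?sqrrN ?normrN.
by rewrite sumr_const card_ord -[leLHS]mulr_natl; lra.
Qed.

Lemma policy_mean_wip (f : gstate d N -> gaction N -> R) x :
  policy_mean (wip_policy nu k) f x = f x (wip_action nu k x).
Proof.
rewrite /policy_mean (bigD1 (wip_action nu k x)) //= /wip_policy eqxx mul1r.
by rewrite big1 ?addr0 // => a /negbTE ->; rewrite mul0r.
Qed.

Lemma wip_is_policy : is_policy (@wip_policy R d N nu k).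
Proof.
split=> [x a|x]; first by rewrite /wip_policy ler0n.
have := policy_mean_wip (fun _ _ => 1) x; rewrite /policy_mean.
by under eq_bigr do rewrite mulr1.
Qed.

(** Each step adds a fresh fluctuation [delta] and amplifies the earlier error by the Lipschitz
    constant. *)
Fixpoint drift_radius (delta : R) (t : nat) : R :=
  if t is t'.+1 then delta + phi_lip R d * drift_radius delta t' else 0.

Lemma phi_lip_ge0 : 0 <= phi_lip R d.
Proof. by rewrite /phi_lip mulr_ge0 ?addr_ge0 ?mulr_ge0 ?ler0n. Qed.

Lemma drift_radius_ge0 delta t : 0 <= delta -> 0 <= drift_radius delta t.
Proof.
by move=> d0; elim: t => //= t IH; rewrite addr_ge0 // mulr_ge0 // phi_lip_ge0.
Qed.

Lemma drift_radiusE delta t : drift_radius delta t = delta * drift_radius 1 t.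
Proof. by elim: t => [|t IH] /=; rewrite ?mulr0 // IH; ring. Qed.

(** Union bound over the steps: if the configuration was close before the last step and that step
    fluctuates by at most [delta], it is still close. *)
Lemma multi_step_concentration x delta t : 0 < delta <= 1 ->
  iter t (kapp (policy_kernel P0 P1 (wip_policy nu k)))
    (fun y => (~~ sup_close (drift_radius delta t) (config y)
                 (Phi P0 P1 alpha t (config x)))%:R) x
  <= t%:R * (2 * d%:R * expR (- (delta ^+ 2 / 8 * N%:R))).
Proof.
move=> dd; have /andP[/ltW d0 _] := dd.
have Kk := policy_kernelP SP0 SP1 wip_is_policy.
elim: t => [|t IH].
  rewrite /= mul0r; suff -> : sup_close 0 (config x) (config x) by [].
  by apply/sup_closeP => i; rewrite subrr normr0.
set q := 2 * d%:R * _ in IH *.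
rewrite iterSr.
apply: (@le_trans _ _ (iter t (kapp (policy_kernel P0 P1 (wip_policy nu k)))
  (fun y => (fun=> q) y + (~~ sup_close (drift_radius delta t) (config y)
                 (Phi P0 P1 alpha t (config x)))%:R) x)); last first.
  by rewrite iter_kappD iter_kapp_cst // -natr1; lra.
apply: ler_iter_kapp => // z; rewrite kapp_policy policy_mean_wip.
have [cl|_] := boolP (sup_close (drift_radius delta t) (config z) _); last first.
  apply: (@le_trans _ _ (\sum_y Ktrans P0 P1 z (wip_action nu k z) y)).
    apply: ler_sum => y _; rewrite ler_piMr ?Ktrans_ge0 //.
    by case: (~~ _).
  by rewrite Ktrans_sum1 // lerDr /q !mulr_ge0 ?expR_ge0 ?ler0n.
rewrite addr0; apply: le_trans _ (one_step_concentration z dd).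
apply: ler_sum => y _; apply: ler_wpM2l; first exact: Ktrans_ge0.
rewrite ler_nat; case: (boolP (sup_close delta _ _)) => // cl2.
  rewrite leqn0 eqb0 negbK /=; apply: sup_close_trans cl2 _.
  apply: (phi_close SP0 SP1 Halpha) => //; first exact: config_simplex.
    by apply: Phi_simplex => //; apply: config_simplex.
  exact: drift_radius_ge0.
by case: (~~ _).
Qed.

End Concentration.

(** * Bounds on the relaxed and the WIP value *)

Section OptimalityGap.
Variables (R : realType) (d N : nat) (P0 P1 : 'M[R]_d) (r0 r1 : 'I_d -> R).
Hypothesis SP0 : stochastic P0.
Hypothesis SP1 : stochastic P1.
Variables (nu g : R) (h : 'I_d -> R).
Hypothesis Hbellman : forall i a, bellmanQ P0 P1 r0 r1 nu h i a <= g + h i.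

Let bellman_value (c : R) : R := N%:R * (g - nu) + nu * c.

Let total_bias (x : gstate d N) : R := \sum_n h (x n).

Lemma total_gap_ge0 (x : gstate d N) a : 0 <= total_gap P0 P1 r0 r1 nu g h x a.
Proof. by apply: sumr_ge0 => n _; rewrite subr_ge0. Qed.

Lemma bias_cvg0 pi (x0 : gstate d N) : is_policy pi ->
  (fun T : nat => T%:R^-1 * (total_bias x0 -
     iter T (kapp (policy_kernel P0 P1 pi)) total_bias x0)) @ \oo --> (0 : R).
Proof.
move=> Hpi; have [b b0 hb] := fin_bounded total_bias.
apply: (@bounded_div_cvg0 _ _ (b + b)) => n.
apply: le_trans (ler_normB _ _) _; rewrite lerD //.
exact: iter_kapp_bounded (policy_kernelP SP0 SP1 Hpi) hb.
Qed.

Lemma policy_value_le pi (x0 : gstate d N) c v : is_policy pi ->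
  as_activation_limit P0 P1 pi x0 c ->
  avg_reward P0 P1 r0 r1 pi x0 n @[n --> \oo] --> v -> v <= bellman_value c.
Proof.
move=> Hpi Hact Hv; have Kk := policy_kernelP SP0 SP1 Hpi.
pose A (T : nat) := T%:R^-1 * \sum_(t < T) iter t (kapp (policy_kernel P0 P1 pi))
       (policy_mean pi (fun _ => @nactive R N)) x0.
have Acvg : A n @[n --> \oo] --> c.
  apply/cvgrPdist_le => e e0.
  have [T0 HT] := activation_limit_mean SP0 SP1 Hpi Hact e0.
  by exists T0 => // n /= nT; rewrite distrC; apply: HT.
have Ucvg : N%:R * (g - nu) + nu * A n + n%:R^-1 * (total_bias x0 -
     iter n (kapp (policy_kernel P0 P1 pi)) total_bias x0) @[n --> \oo]
    --> bellman_value c + 0.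
  apply: cvgD; last exact: bias_cvg0.
  apply: cvgD; first exact: cvg_cst.
  by apply: cvgM; [exact: cvg_cst|].
rewrite addr0 in Ucvg; apply: ler_cvg_to Hv Ucvg _.
exists 1%N => // n /= n1.
rewrite (avg_reward_bellman r0 r1 SP0 SP1 Hpi nu g h x0 n1) -/(A n).
rewrite lerD2r gerBl mulr_ge0 ?invr_ge0 ?ler0n //.
apply: sumr_ge0 => t _; rewrite -[leLHS](congr1 (fun f => f x0) (iter_kapp_cst t 0 Kk)).
apply: ler_iter_kapp => // x; apply: sumr_ge0 => a _.
by rewrite mulr_ge0 ?total_gap_ge0 //; case: Hpi.
Qed.

(** The bound [q] holds after [T0] steps from every state, so by the Markov property at every later
    time; the first [T0] steps cost at most [T0 * B], which vanishes on average. *)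
Lemma policy_value_ge pi (x0 : gstate d N) c v B q T0 : is_policy pi ->
  (forall x, policy_mean pi (fun _ => @nactive R N) x = c) ->
  (forall x, policy_mean pi (total_gap P0 P1 r0 r1 nu g h) x <= B) ->
  (forall x, iter T0 (kapp (policy_kernel P0 P1 pi))
      (policy_mean pi (total_gap P0 P1 r0 r1 nu g h)) x <= q) ->
  0 <= B -> 0 <= q ->
  avg_reward P0 P1 r0 r1 pi x0 n @[n --> \oo] --> v -> bellman_value c - q <= v.
Proof.
move=> Hpi actc gapB gapq B0 q0 Hv; have Kk := policy_kernelP SP0 SP1 Hpi.
set G := policy_mean pi (total_gap _ _ _ _ _ _ _) in gapB gapq.
set K := kapp _ in gapq.
have Gsum n : \sum_(t < n) iter t K G x0 <= n%:R * q + T0%:R * B.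
  apply: (@le_trans _ _ (\sum_(t < n) (q + (t < T0)%:R * B))).
    apply: ler_sum => t _; have [tT|tT] := ltnP t T0.
      rewrite mul1r; apply: ler_wpDl => //.
      rewrite -[leRHS](congr1 (fun f => f x0) (iter_kapp_cst t B Kk)).
      exact: ler_iter_kapp.
    rewrite mul0r addr0 -(subnK tT) iterD.
    rewrite -[leRHS](congr1 (fun f => f x0) (iter_kapp_cst (t - T0) q Kk)).
    exact: ler_iter_kapp.
  rewrite big_split /= sumr_const card_ord -[q *+ n]mulr_natl lerD2l -mulr_suml.
  apply: ler_wpM2r => //; rewrite -natr_sum ler_nat.
  (* The bound by [T0] alone is not inductive; the minimum with [n] is. *)
  suff : (\sum_(t < n) (t < T0 : nat) <= minn n T0)%N by rewrite leq_min => /andP[].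
  elim: n => [|n IH]; first by rewrite big_ord0.
  rewrite big_ord_recr /=; move: (bigop _ _ _) IH => S IH.
  by have [nT|nT] := ltnP n T0; move: IH; rewrite !leq_min /=; lia.
have Lcvg : bellman_value c - q - n%:R^-1 * (T0%:R * B) + n%:R^-1 * (total_bias x0 -
     iter n (kapp (policy_kernel P0 P1 pi)) total_bias x0) @[n --> \oo]
    --> bellman_value c - q - 0 + 0.
  apply: cvgD; last exact: bias_cvg0.
  apply: cvgB; first exact: cvg_cst.
  exact: (@bounded_div_cvg0 _ _ `|T0%:R * B|).
rewrite addr0 subr0 in Lcvg; apply: ler_cvg_to Lcvg Hv _.
exists 1%N => // n /= n1.
have n0 : (0 : R) < n%:R by rewrite ltr0n.
rewrite (avg_reward_bellman r0 r1 SP0 SP1 Hpi nu g h x0 n1) lerD2r.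
have -> : policy_mean pi (fun _ => @nactive R N) = (fun=> c) by apply/funext.
under [X in _ <= _ + _ * (_ * X) - _]eq_bigr do rewrite iter_kapp_cst //.
rewrite sumr_const card_ord -(mulr_natl c n) mulKf ?gt_eqF //.
rewrite /bellman_value -addrA lerD2l -opprD lerN2.
by rewrite ler_pdivrMl // mulrDr mulVKf ?gt_eqF.
Qed.

End OptimalityGap.

Lemma wip_activation_limit (R : realType) (d N : nat) (P0 P1 : 'M[R]_d)
  (nu : 'I_d -> R) (k : nat) (x0 : gstate d N) :
  (forall i j : 'I_d, (i < j)%N -> nu j < nu i) -> (k <= N)%N ->
  as_activation_limit P0 P1 (wip_policy nu k) x0 k%:R.
Proof.
(* Paths of positive probability follow WIP and activate exactly [k] bandits at each time, so every
   average over at least one step equals [k]; the empty average would be 0. *)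
move=> Hnu kN eps delta e0 d0; exists 1%N; split=> // L L1.
rewrite big1 ?ltW // => p /existsP[T' /andP[T1 dev]].
have [/forallP allw|/forallPn[t pt]] := boolP [forall t : 'I_L,
    (path_at x0 p t).2 == wip_action nu k (path_at x0 p t).1]; last first.
  by apply: (@path_prob_eq0 _ _ _ _ _ _ _ _ _ t); rewrite /wip_policy (negbTE pt).
move: dev; rewrite (eq_bigr (fun=> k%:R)) => [|t _].
  rewrite sumr_const card_ord -(mulr_natl (k%:R : R) T') mulKf.
    by rewrite subrr normr0 ltNge ltW.
  by rewrite pnatr_eq0 -lt0n.
have tL : (t < L)%N := leq_trans (ltn_ord t) (ltn_ord T' : (T' <= L)%N).
by have /eqP -> := allw (Ordinal tL); apply: nactive_wip.
Qed.

(** When the budget runs out in [s], a rank below [k] forces a state up to [s] and a rank from [k]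
    on forces a state from [s] on; these actions are tight in the Bellman equation. *)
Lemma wip_total_gap_eq0 (R : realType) (d N : nat) (P0 P1 : 'M[R]_d)
  (r0 r1 nu : 'I_d -> R) (alpha nus g : R) (h : 'I_d -> R) (k : nat) (s : 'I_d)
  (x : gstate d N) :
  (forall i j : 'I_d, (i < j)%N -> nu j < nu i) ->
  alpha * N%:R = k%:R -> (0 < N)%N ->
  (forall i : 'I_d, (i <= s)%N -> bellmanQ P0 P1 r0 r1 nus h i true = g + h i) ->
  (forall i : 'I_d, (s <= i)%N -> bellmanQ P0 P1 r0 r1 nus h i false = g + h i) ->
  cumul (config R x) s <= alpha <= cumul (config R x) s.+1 ->
  total_gap P0 P1 r0 r1 nus g h x (wip_action nu k x) = 0.
Proof.
move=> Hnu Hk N0 act pas /andP[lo hi].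
have NR : (0 : R) < N%:R by rewrite ltr0n.
have occ_lo : (occupation x s <= k)%N.
  by rewrite -(ler_nat R) -Hk -(cumul_config _ N0) mulrC ler_pM2r.
have occ_hi : (k <= occupation x s.+1)%N.
  by rewrite -(ler_nat R) -Hk -(cumul_config _ N0) [leRHS]mulrC ler_pM2r.
apply: big1 => n _; rewrite /bellman_gap; apply/eqP; rewrite subr_eq0 eq_sym; apply/eqP.
rewrite wip_actionE //; have [lt|ge] := ltnP (priority_rank x n) k.
  by apply: act; rewrite -ltnS -priority_rank_occupation (leq_trans lt).
apply: pas; rewrite leqNgt -priority_rank_occupation -leqNgt.
exact: leq_trans occ_lo ge.
Qed.

(** Half of the exponential rate absorbs the linear prefactor, by [1 + u <= expR u] at
    [u = c / 2 * y]. *)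
Lemma mul_expR_le (R : realType) (c y : R) : 0 < c ->
  y * expR (- (c * y)) <= 2 / c * expR (- (c / 2 * y)).
Proof.
move=> c0; have -> : - (c * y) = - (c / 2 * y) + - (c / 2 * y) by field.
rewrite expRD mulrA; apply: ler_wpM2r; first exact: expR_ge0.
rewrite expRN ler_pdivrMr ?expR_gt0 //.
have c2 : 0 <= 2 / c by rewrite divr_ge0 // ltW.
apply: le_trans (ler_wpM2l c2 (expR_ge1Dx (c / 2 * y))).
have -> : 2 / c * (1 + c / 2 * y) = 2 / c + y by field; rewrite gt_eqF.
by rewrite lerDr.
Qed.

Theorem theorem2 (R : realType) (d : nat) (P0 P1 : 'M[R]_d)
  (r0 r1 : 'I_d -> R) (alpha : R) (mstar : 'I_d -> R) :
  (2 <= d)%N ->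
  stochastic P0 -> stochastic P1 ->
  0 < alpha < 1 ->
  (* (i) unichain and strictly indexable (labels: nu_1 > ... > nu_d) *)
  unichain P0 P1 ->
  strictly_indexable_labeled P0 P1 r0 r1 ->
  (* (ii) mstar is the fixed point of phi and a uniform global attractor *)
  simplex mstar ->
  phi P0 P1 alpha mstar = mstar ->
  uniform_global_attractor P0 P1 alpha mstar ->
  (* (iii) mstar is not singular *)
  ~ singular alpha mstar ->
  exists b c : R, 0 < b /\ 0 < c /\
    forall (N k : nat), alpha * N%:R = k%:R ->
    forall x0 : gstate d N,
      0 <= V_rel P0 P1 r0 r1 alpha x0 - V_WIP P0 P1 r0 r1 k x0 /\
      V_rel P0 P1 r0 r1 alpha x0 - V_WIP P0 P1 r0 r1 k x0
        <= b * expR (- (c * N%:R)).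
Proof.
move=> d2 SP0 SP1 Ha Huni [Hidx Hstrict] ms _ attr nsing.
have [s [_ /andP[sa sb]]] := s_ofP Ha ms.
(* Non-singularity makes this bound strict; for [s = 0] the sum is empty and [alpha > 0] is used
   instead. *)
have {}sa : cumul mstar s < alpha.
  rewrite lt_neqAle sa andbT; apply/eqP => E.
  have [s0|s0] := posnP s.
    by case/andP: Ha => a0 _; move: a0; rewrite -E s0 cumul0 ltxx.
  have sd : (s.-1 < d)%N by rewrite (leq_ltn_trans (leq_pred _)).
  apply: nsing; exists (Ordinal sd); rewrite -E; apply: eq_bigl => j /=.
  by rewrite -[in RHS](prednK s0) ltnS.
have dR : (0 : R) < d%:R by rewrite ltr0n (leq_trans _ d2).
pose margin := Num.min (alpha - cumul mstar s) (cumul mstar s.+1 - alpha).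
have margin0 : 0 < margin by rewrite /margin lt_min !subr_gt0 sa sb.
(* A cumulative mass adds at most [d] coordinates, so closeness [eps] to [mstar] keeps the budget
   running out in [s]. *)
pose eps := margin / d%:R.
have eps0 : 0 < eps by rewrite divr_gt0.
have [T0 HT0] := attr (eps / 2) (divr_gt0 eps0 (ltr0Sn _ 1)).
pose rho := drift_radius d (1 : R) T0.
have rho0 : 0 <= rho by apply: drift_radius_ge0.
(* The radius is linear in [delta], so random fluctuations over [T0] steps use at most half of
   [eps], the other half being left to the attraction. The cap 1 serves the Chernoff bound, and
   [rho + 1] avoids dividing by zero. *)
pose delta := Num.min 1 (eps / 2 / (rho + 1)).
have delta01 : 0 < delta <= 1.
  by rewrite /delta ge_min lexx andbT lt_min ltr01 /= !divr_gt0 // ltr_wpDl.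
have drift_le : drift_radius d delta T0 <= eps / 2.
  rewrite drift_radiusE -/rho; have /andP[del0 _] := delta01.
  have : delta <= eps / 2 / (rho + 1) by rewrite /delta ge_min lexx orbT.
  rewrite ler_pdivlMr ?ltr_wpDl // => h.
  by apply: le_trans h; rewrite ler_pM2l // lerDl.
have [g [h [Hbell act pas]]] := whittle_bellman SP0 SP1 Huni Hidx Hstrict s.
set nus := whittle P0 P1 r0 r1 s in Hbell act pas.
have [G G0 HG] := fin_bounded (fun ia : 'I_d * bool => bellman_gap P0 P1 r0 r1 nus g h ia.1 ia.2).
pose c0 := delta ^+ 2 / 8.
have c00 : 0 < c0 by case/andP: delta01 => del0 _; rewrite divr_gt0 // exprn_gt0.
pose C := G * (T0%:R * (2 * d%:R)).
have C0 : 0 <= C by rewrite !mulr_ge0 ?ler0n.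
(* The prefactor [N] of the gap costs half of the rate [c0]; the summand 1 keeps the constant
   positive when [C = 0]. *)
exists (C * (2 / c0) + 1), (c0 / 2); split.
  by rewrite ltr_wpDl // mulr_ge0 // divr_ge0 // ltW.
split=> [|N k Hk x0]; first by rewrite divr_gt0.
have kN := budget_le Ha Hk.
set wp := @wip_policy R d N (whittle P0 P1 r0 r1) k.
have Hwp : is_policy wp by apply: wip_is_policy.
have Kk := policy_kernelP SP0 SP1 Hwp.
have [v Hv] := avg_reward_cvg r0 r1 SP0 SP1 Hwp x0.
have VE : V_WIP P0 P1 r0 r1 k x0 = v by apply: cvg_lim.
pose U := N%:R * (g - nus) + nus * k%:R.
pose VS := [set v : R | exists pi : gstate d N -> gaction N -> R,
         [/\ is_policy pi,
             as_activation_limit P0 P1 pi x0 (alpha * N%:R) &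
             avg_reward P0 P1 r0 r1 pi x0 n @[n --> \oo] --> v]].
have VSub : ubound VS U.
  move=> w [pi [Hpi Hact Hw]]; rewrite /U -Hk.
  exact (policy_value_le SP0 SP1 Hbell Hpi Hact Hw).
(* WIP is itself admissible, so its value lies in the set; with the bound [U] the supremum is
   genuine and dominates it. *)
have VSv : VS v.
  exists wp; split=> //; rewrite Hk; exact: wip_activation_limit.
have -> : V_rel P0 P1 r0 r1 alpha x0 = sup VS by [].
rewrite VE; split.
  by rewrite subr_ge0; apply: ub_le_sup => //; exists U.
(* The largest possible total gap times the probability of being away from [mstar] after [T0]
   steps. *)
pose q := N%:R * G * (T0%:R * (2 * d%:R * expR (- (c0 * N%:R)))).
have q0 : 0 <= q by rewrite !mulr_ge0 ?expR_ge0 ?ler0n.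
have gapG (x : gstate d N) a : total_gap P0 P1 r0 r1 nus g h x a <= N%:R * G.
  apply: (@le_trans _ _ (\sum_(n < N) G)).
    by apply: ler_sum => n _; apply: le_trans (ler_norm _) (HG (x n, a n)).
  by rewrite sumr_const card_ord mulr_natl.
have gapq (x : gstate d N) : iter T0 (kapp (policy_kernel P0 P1 wp))
    (policy_mean wp (total_gap P0 P1 r0 r1 nus g h)) x <= q.
  (* Concentration needs [N > 0]; without bandits every gap is an empty sum. *)
  have [N0|N0] := posnP N.
    have -> : policy_mean wp (total_gap P0 P1 r0 r1 nus g h) = (fun=> 0).
      apply/funext => y; rewrite policy_mean_wip; apply: big1 => n _.
      by have := ltn_ord n; rewrite {2}N0.
    by rewrite iter_kapp_cst.
  have step := multi_step_concentration SP0 SP1 Hstrict Ha Hk N0 x T0 delta01.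
  apply: le_trans (ler_wpM2l (mulr_ge0 (ler0n _ N) G0) step).
  rewrite -[leRHS](congr1 (fun f => f x) (iter_kappZ _ T0 (N%:R * G) _)).
  apply: ler_iter_kapp => // y.
  rewrite policy_mean_wip.
  have [cl|ncl] := boolP (sup_close _ (config R y) _); last by rewrite mulr1 gapG.
  rewrite mulr0 le_eqVlt; apply/orP; left; apply/eqP.
  apply: (wip_total_gap_eq0 Hstrict Hk N0 act pas).
  have cl2 : sup_close (eps / 2) (Phi P0 P1 alpha T0 (config R x)) mstar.
    apply/sup_closeP => i.
    apply: le_trans _ (HT0 T0 (leqnn _) _ (config_simplex R N0 x)).
    exact: (le_bigmax _ (fun j => `|Phi P0 P1 alpha T0 (config R x) j - mstar j|)).
  have cl3 : sup_close eps (config R y) mstar.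
    have /sup_closeP H := sup_close_trans cl cl2.
    by apply/sup_closeP => i; apply: le_trans (H i) _; lra.
  have md : d%:R * eps = margin by rewrite /eps mulrC divfK // gt_eqF.
  have ml : margin <= alpha - cumul mstar s by rewrite /margin ge_min lexx.
  have mr : margin <= cumul mstar s.+1 - alpha by rewrite /margin ge_min lexx orbT.
  have := cumul_close s (ltW eps0) cl3; have := cumul_close s.+1 (ltW eps0) cl3.
  by rewrite md !ler_norml => /andP[h1 h2] /andP[h3 h4]; apply/andP; split; lra.
have vge : U - q <= v.
  apply: (policy_value_ge SP0 SP1 Hwp _ _ gapq _ q0 Hv) => [x|x|].
  - by rewrite policy_mean_wip nactive_wip.
  - by rewrite policy_mean_wip; apply: gapG.
  - by rewrite mulr_ge0.
have supU : sup VS <= U by apply: ge_sup => //; exists v.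
apply: (@le_trans _ _ q); first lra.
have -> : q = C * (N%:R * expR (- (c0 * N%:R))) by rewrite /q /C; ring.
have := ler_wpM2l C0 (mul_expR_le N%:R c00).
by have := expR_ge0 (- (c0 / 2 * N%:R)); lra.
Qed.
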